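(* Let $A$ be a basic semiperfect Noetherian $k$-algebra with $A/\mathrm{rad}A$ finite dimensional over $k$, let $e$ be a primitive idempotent of $A$, let $\Gamma=(1-e)A(1-e)$ and $S_e=eA/e\,\mathrm{rad}A$. Assume that $\mathrm{Ext}^1_A(S_e,S_e)=0$. If both $\mathrm{pd}_A S_e$ and $\mathrm{pd}_\Gamma F(eA)$ are finite, where $F(eA)=\mathrm{Hom}_A((1-e)A,eA)\cong eA(1-e)$ as a right $\Gamma$-module, then $S_e$ is self-orthogonal, that is, $\mathrm{Ext}^i_A(S_e,S_e)=0$ for all $i>0$.
   Context: $k$ is an algebraically closed field. Algebras are associative and unital; Noetherian means left and right Noetherian. $\mathrm{rad}A$ is the Jacobson radical of $A$. Semiperfect means that $A/\mathrm{rad}A$ is semisimple and idempotents lift modulo $\mathrm{rad}A$; basic means that $A/\mathrm{rad}A$ is a finite product of division algebras (here necessarily copies of $k$). Modules are right modules; $\mathrm{pd}$ denotes projective dimension. *)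

(* Defs.v *)
From HB Require Import structures.
From mathcomp Require Import all_boot all_order all_algebra.
From mathcomp Require Import boolp.
From mathcomp Require classical_sets.

Set Implicit Arguments.
Unset Strict Implicit.
Unset Printing Implicit Defensive.

Import GRing.Theory.
Local Open Scope ring_scope.
Local Open Scope quotient_scope.

(* A right R-module is a left module over the converse ring: the right action
   x.a is written a *: x with a : R^c.  The regular right module is R^c^o, and
   its submodules are the right ideals of R. *)
Notation rmodType R := (lmodType R^c).

Section Submodules.
Variables (R : pzRingType) (M : lmodType R).
Implicit Types S T : {pred M}.

Definition maximal_submod S :=
  [/\ submod_closed S, exists x, x \notin S
    & forall T, submod_closed T -> {subset S <= T} -> (exists x, x \notin T) ->
        {subset T <= S}].

Definition simple_submod S :=
  [/\ submod_closed S, exists2 x, x \in S & x != 0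
    & forall T, submod_closed T -> {subset T <= S} ->
        (exists2 x, x \in T & x != 0) -> {subset S <= T}].

Definition semisimple :=
  forall x : M, exists (n : nat) (S : 'I_n -> {pred M}) (y : 'I_n -> M),
    [/\ forall i, simple_submod (S i), forall i, y i \in S i
      & x = \sum_i y i].

Definition noetherian :=
  forall S : nat -> {pred M},
    (forall n, submod_closed (S n)) -> (forall n, {subset S n <= S n.+1}) ->
    exists n, forall m, (n <= m)%N -> S m =i S n.

End Submodules.
Arguments semisimple {R} M.
Arguments noetherian {R} M.

Definition noetherian_ring (R : pzRingType) :=
  noetherian R^o /\ noetherian (R^c)^o.

Definition semisimple_ring (R : pzRingType) := semisimple (R^c)^o.

Definition division_ring (R : nzRingType) :=
  forall x : R, x != 0 -> exists y, x * y = 1 /\ y * x = 1.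

Definition finite_dimensional (k : fieldType) (V : lmodType k) :=
  exists (n : nat) (b : 'I_n -> V),
    forall v : V, exists c : 'I_n -> k, v = \sum_i c i *: b i.

Section SubmoduleType.
Variables (R : pzRingType) (M : lmodType R) (S : submodClosed M).

Record submod : Type := Submod { submod_val : M; _ : submod_val \in S }.

HB.instance Definition _ := [isSub for submod_val].
HB.instance Definition _ := [Choice of submod by <:].
HB.instance Definition _ := [SubChoice_isSubLmodule of submod by <:].

End SubmoduleType.

Section QuotientModule.
Variables (R : pzRingType) (M : lmodType R) (S : submodClosed M).

(* submodClosed does not extend zmodClosed in the library. *)
Definition submod_pred : {pred M} := S.

Lemma submod_pred_closed : zmod_closed submod_pred.
Proof. exact: GRing.submod_closedB (GRing.submodClosedP S). Qed.

HB.instance Definition _ := GRing.isZmodClosed.Build M submod_pred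
  submod_pred_closed.

Definition quotmod : Type := Quotient.quot submod_pred.
HB.instance Definition _ := GRing.Zmodule.on quotmod.

Definition quotmod_proj (x : M) : quotmod := \pi_(Quotient.quot submod_pred) x.

Definition quotmod_scale (a : R) (x : quotmod) : quotmod :=
  quotmod_proj (a *: repr (x : Quotient.quot submod_pred)).

Lemma quotmod_projP x y : (quotmod_proj x == quotmod_proj y) = (x - y \in S).
Proof. by rewrite /quotmod_proj -Quotient.idealrBE. Qed.

Lemma quotmod_projK (x : quotmod) :
  quotmod_proj (repr (x : Quotient.quot submod_pred)) = x.
Proof. exact: reprK. Qed.

Lemma quotmod_projZ a x : quotmod_proj (a *: x) = quotmod_scale a (quotmod_proj x).
Proof.
apply/eqP; rewrite quotmod_projP -scalerBr rpredZ // -quotmod_projP.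
by rewrite quotmod_projK.
Qed.

Lemma quotmod_projD x y :
  quotmod_proj (x + y) = quotmod_proj x + quotmod_proj y.
Proof. exact: (raddfD (\pi_(Quotient.quot submod_pred))). Qed.

Lemma quotmod_scaleA a b v :
  quotmod_scale a (quotmod_scale b v) = quotmod_scale (a * b) v.
Proof. by rewrite -[v]quotmod_projK -!quotmod_projZ scalerA. Qed.

Lemma quotmod_scale1 : left_id 1 quotmod_scale.
Proof. by move=> v; rewrite -[v]quotmod_projK -quotmod_projZ scale1r. Qed.

Lemma quotmod_scaleDr : right_distributive quotmod_scale +%R.
Proof.
move=> a u v; rewrite -[u]quotmod_projK -[v]quotmod_projK.
by rewrite -quotmod_projD -!quotmod_projZ scalerDr quotmod_projD.
Qed.

Lemma quotmod_scaleDl v : {morph quotmod_scale^~ v : a b / a + b}.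
Proof.
move=> a b; rewrite -[v]quotmod_projK.
by rewrite -!quotmod_projZ scalerDl quotmod_projD.
Qed.

HB.instance Definition _ := GRing.Zmodule_isLmodule.Build R quotmod
  quotmod_scaleA quotmod_scale1 quotmod_scaleDr quotmod_scaleDl.

Lemma quotmod_proj_is_linear : linear quotmod_proj.
Proof. by move=> a x y; rewrite quotmod_projD quotmod_projZ. Qed.

HB.instance Definition _ :=
  GRing.isLinear.Build R M quotmod _ quotmod_proj quotmod_proj_is_linear.

End QuotientModule.
Arguments quotmod {R M} S.
Arguments quotmod_proj {R M} S x.

Section Jacobson.
Variable R : pzRingType.

Definition jacobson : {pred R} :=
  [pred x | `[< forall S : {pred (R^c)^o}, maximal_submod S -> x \in S >]].

Lemma jacobsonP (x : R) :
  reflect (forall S : {pred (R^c)^o}, maximal_submod S -> (x : (R^c)^o) \in S)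
    (x \in jacobson).
Proof. exact: asboolP. Qed.

Lemma rideal_closedMr (S : {pred (R^c)^o}) (x a : R) :
  submod_closed S -> (x : (R^c)^o) \in S -> ((x * a : R) : (R^c)^o) \in S.
Proof.
move=> [S0 SZ] xS; have := SZ (a : R^c) x 0 xS S0.
by rewrite addr0.
Qed.

Lemma rideal_closedD (S : {pred (R^c)^o}) (x y : R) :
  submod_closed S -> (x : (R^c)^o) \in S -> (y : (R^c)^o) \in S ->
  ((x + y : R) : (R^c)^o) \in S.
Proof.
by move=> [S0 SZ] xS yS; have := SZ (1 : R^c) x y xS yS; rewrite scale1r.
Qed.

Lemma jacobsonMr (x a : R) : x \in jacobson -> x * a \in jacobson.
Proof.
move=> /jacobsonP xJ; apply/jacobsonP => S mS.
by apply: rideal_closedMr; [case: mS | exact: xJ].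
Qed.

Lemma jacobson_zmod_closed : zmod_closed jacobson.
Proof.
split=> [|x y /jacobsonP xJ /jacobsonP yJ]; apply/jacobsonP => S mS.
  by case: mS => -[].
have [cS _ _] := mS; apply: rideal_closedD (xJ _ mS) _ => //.
by rewrite -mulrN1; apply: rideal_closedMr => //; exact: yJ.
Qed.

HB.instance Definition _ := GRing.isZmodClosed.Build R jacobson
  jacobson_zmod_closed.

Lemma jacobsonMl (a x : R) : x \in jacobson -> a * x \in jacobson.
Proof.
move=> /jacobsonP xJ; apply/jacobsonP => S mS; have [cS pS maxS] := mS.
case aS: ((a : (R^c)^o) \in S); first exact: rideal_closedMr.
pose N : {pred (R^c)^o} := [pred y | ((a * (y : R) : R) : (R^c)^o) \in S].
suff mN : maximal_submod N by exact: (xJ N mN).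
have cN : submod_closed N.
  split=> [|b u v uN vN]; rewrite !inE ?mulr0; first by case: cS.
  rewrite mulrDr; apply: rideal_closedD => //.
  by rewrite -[b *: u]/((u : R) * (b : R)) mulrA; apply: rideal_closedMr.
have nN : exists y, y \notin N by exists 1; rewrite !inE mulr1 aS.
split=> // T cT NT [z zT] t tT.
apply/negPn/negP => tN.
pose S' : {pred (R^c)^o} := [pred y | `[< exists (m b : R),
  (m : (R^c)^o) \in S /\ y = m + a * (t : R) * b >]].
have cS' : submod_closed S'.
  split=> [|b u v /asboolP[m [c [mS' ->]]] /asboolP[m' [c' [mS'' ->]]]].
    apply/asboolP; exists 0, 0; split; first by case: cS.
    by rewrite mulr0 addr0.
  apply/asboolP; exists (m * (b : R) + m'), (c * (b : R) + c'); split.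
    by apply: rideal_closedD => //; apply: rideal_closedMr.
  rewrite -[b *: _]/((m + a * (t : R) * c) * (b : R)).
  by rewrite mulrDl mulrDr !mulrA addrACA.
have SS' : {subset S <= S'}.
  by move=> y yS; apply/asboolP; exists y, 0; rewrite mulr0 addr0.
have /asboolP[m [b [mS' Da]]] : (a : (R^c)^o) \in S'.
  apply/negPn/negP => aS'.
  have nS' : exists y, y \notin S' by exists (a : (R^c)^o).
  have atS := maxS _ cS' SS' nS' (a * (t : R) : R); move: tN.
  rewrite inE /= => /negP; apply; apply: atS; apply/asboolP; exists 0, 1.
  by rewrite mulr1 add0r; split=> //; case: cS.
have /NT bT : ((1 - (t : R) * b : R) : (R^c)^o) \in N.
  by rewrite inE /= mulrBr mulr1 mulrA {1}Da addrK.
have : ((1 : R) : (R^c)^o) \in T.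
  rewrite -[1](subrK ((t : R) * b)).
  by apply: rideal_closedD => //; apply: rideal_closedMr.
move=> /(rideal_closedMr (z : R) cT); rewrite mul1r => zT'.
by rewrite zT' in zT.
Qed.

End Jacobson.
Arguments jacobson R : clear implicits.

Lemma jacobson1 (R : nzRingType) : (1 : R) \notin jacobson R.
Proof.
pose proper (S : {pred (R^c)^o}) := submod_closed S /\ 1 \notin S.
pose le (S T : {S | proper S}) := `[< {subset sval S <= sval T} >].
have proper0 : proper (pred1 0).
  split; last by rewrite inE oner_eq0.
  by split=> [|a u v]; rewrite !inE // => /eqP-> /eqP->; rewrite scaler0 addr0.
have [||F totF|[S [cS S1]] maxS] :=
    @classical_sets.ZL_preorder _ (exist _ _ proper0) le.
- by move=> S; apply/asboolP.
- by move=> S T U /asboolP ST /asboolP TU; apply/asboolP => x /ST/TU.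
- have [[S0 FS0]|nF] := pselect (exists S, F S); last first.
    by exists (exist _ _ proper0) => S FS; case: nF; exists S.
  pose U : {pred (R^c)^o} := [pred x | `[< exists2 S, F S & x \in sval S >]].
  have pU : proper U.
    split; last by apply/negP => /asboolP[S _]; case: S => S [cS /= /negP].
    split=> [|a u v /asboolP[S FS uS] /asboolP[T FT vT]].
      by apply/asboolP; exists S0 => //; case: (S0) => S [[]].
    apply/asboolP; have [/asboolP ST|/asboolP TS] := totF _ _ FS FT.
      exists T => //; case: T FT vT ST => T [[T0 TZ] _] /= _ vT ST.
      by apply: TZ => //; exact: ST.
    exists S => //; case: S FS uS TS => S [[_ SZ] _] /= _ uS TS.
    by apply: SZ => //; exact: TS.
  exists (exist _ _ pU) => S FS; apply/asboolP => x xS; apply/asboolP.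
  by exists S.
apply/negP => /jacobsonP/(_ S) => SP; have /negP := S1; apply; apply: SP; split=> //.
  by exists 1; rewrite S1.
move=> T cT ST [z zT].
have pT : proper T.
  split=> //; apply/negP => /(rideal_closedMr (z : R) cT).
  by rewrite mul1r (negPf zT).
have ST' : le (exist _ _ (conj cS S1)) (exist _ _ pT) by apply/asboolP.
by have /asboolP := maxS _ ST'.
Qed.

Section RadicalQuotient.
Variables (k : fieldType) (A : algType k).

Lemma jacobsonZ : GRing.scaler_closed (jacobson A : {pred A}).
Proof. by move=> c x xJ; rewrite -mulr_algl jacobsonMl. Qed.

HB.instance Definition _ :=
  GRing.isScaleClosed.Build k A (jacobson A) jacobsonZ.

Definition radquot : Type := quotmod (jacobson A : submodClosed A).
HB.instance Definition _ := GRing.Lmodule.on radquot.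

Definition radquot_proj : A -> radquot := quotmod_proj _.

HB.instance Definition _ := GRing.Linear.on radquot_proj.

Lemma radquot_projP x y :
  (radquot_proj x == radquot_proj y) = (x - y \in jacobson A).
Proof. exact: quotmod_projP. Qed.

Lemma radquot_ind (P : radquot -> Prop) :
  (forall x, P (radquot_proj x)) -> forall x, P x.
Proof. by move=> PA x; rewrite -[x]quotmod_projK; apply: PA. Qed.

Definition radquot_lift (x : radquot) : A :=
  repr (x : Quotient.quot (submod_pred (jacobson A : submodClosed A))).

Definition radquot_mul (x y : radquot) : radquot :=
  radquot_proj (radquot_lift x * radquot_lift y).

Lemma radquot_liftK : cancel radquot_lift radquot_proj.
Proof. exact: quotmod_projK. Qed.

Lemma radquot_projM x y :
  radquot_mul (radquot_proj x) (radquot_proj y) = radquot_proj (x * y).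
Proof.
apply/eqP; rewrite radquot_projP.
set x' := radquot_lift _; set y' := radquot_lift _.
have xx' : x' - x \in jacobson A by rewrite -radquot_projP radquot_liftK.
have yy' : y' - y \in jacobson A by rewrite -radquot_projP radquot_liftK.
rewrite -[x' * y'](subrK (x * y')) -mulrBl -addrA -mulrBr.
by apply: rpredD; [apply: jacobsonMr | apply: jacobsonMl].
Qed.

Lemma radquot_mulA : associative radquot_mul.
Proof.
apply: radquot_ind => x; apply: radquot_ind => y; apply: radquot_ind => z.
by rewrite !radquot_projM mulrA.
Qed.

Lemma radquot_mul1l : left_id (radquot_proj 1) radquot_mul.
Proof. by apply: radquot_ind => x; rewrite radquot_projM mul1r. Qed.

Lemma radquot_mul1r : right_id (radquot_proj 1) radquot_mul.
Proof. by apply: radquot_ind => x; rewrite radquot_projM mulr1. Qed.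

Lemma radquot_mulDl : left_distributive radquot_mul +%R.
Proof.
apply: radquot_ind => x; apply: radquot_ind => y; apply: radquot_ind => z.
by rewrite -raddfD !radquot_projM mulrDl raddfD.
Qed.

Lemma radquot_mulDr : right_distributive radquot_mul +%R.
Proof.
apply: radquot_ind => x; apply: radquot_ind => y; apply: radquot_ind => z.
by rewrite -raddfD !radquot_projM mulrDr raddfD.
Qed.

Lemma radquot_oner_neq0 : radquot_proj 1 != 0.
Proof. by rewrite -(raddf0 radquot_proj) radquot_projP subr0 jacobson1. Qed.

HB.instance Definition _ := GRing.Zmodule_isNzRing.Build radquot
  radquot_mulA radquot_mul1l radquot_mul1r radquot_mulDl radquot_mulDr
  radquot_oner_neq0.

Lemma radquot_proj_is_monoid_morphism : monoid_morphism radquot_proj.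
Proof. by split=> // x y; rewrite -radquot_projM. Qed.

HB.instance Definition _ := GRing.isMonoidMorphism.Build A radquot radquot_proj
  radquot_proj_is_monoid_morphism.

Lemma radquot_projZ (c : k) (x : A) :
  radquot_proj (c *: x) = c *: radquot_proj x.
Proof. exact: linearZ. Qed.

Lemma radquot_scaleAl (c : k) (x y : radquot) : c *: (x * y) = c *: x * y.
Proof.
move: x y; apply: radquot_ind => x; apply: radquot_ind => y.
by rewrite -radquot_projZ -!rmorphM -radquot_projZ scalerAl.
Qed.

HB.instance Definition _ :=
  GRing.Lmodule_isLalgebra.Build k radquot radquot_scaleAl.

Lemma radquot_scaleAr (c : k) (x y : radquot) : c *: (x * y) = x * (c *: y).
Proof.
move: x y; apply: radquot_ind => x; apply: radquot_ind => y.
by rewrite -radquot_projZ -!rmorphM -radquot_projZ scalerAr.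
Qed.

HB.instance Definition _ :=
  GRing.Lalgebra_isAlgebra.Build k radquot radquot_scaleAr.

End RadicalQuotient.
Arguments radquot {k} A.
Arguments radquot_proj {k A} x.

Section AlgebraProperties.
Variables (k : fieldType) (A : algType k).

Definition semiperfect_algebra :=
  semisimple_ring (radquot A) /\
  forall x : radquot A, x * x = x ->
    exists2 f : A, f * f = f & radquot_proj f = x.

(* A / rad A is isomorphic, via the maps p i, to the product of the D i. *)
Definition basic_algebra :=
  exists (n : nat) (D : 'I_n -> algType k)
         (p : forall i, {lrmorphism radquot A -> D i}),
    (forall i, division_ring (D i)) /\
    (forall y : forall i, D i, exists! x : radquot A, forall i, p i x = y i).

End AlgebraProperties.
Arguments semiperfect_algebra {k} A.
Arguments basic_algebra {k} A.

Record idem_elt (R : pzRingType) := IdemElt {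
  idem_val :> R;
  idem_mul : idem_val * idem_val = idem_val
}.

Definition primitive_idem (R : pzRingType) (e : idem_elt R) :=
  (e : R) != 0 /\
  forall f g : idem_elt R, (f : R) * (g : R) = 0 -> (g : R) * (f : R) = 0 ->
    (e : R) = (f : R) + (g : R) -> (f : R) = 0 \/ (g : R) = 0.

Section Complement.
Variables (R : pzRingType) (e : idem_elt R).

Lemma idem_compl_mul : (1 - (e : R)) * (1 - (e : R)) = 1 - (e : R).
Proof. by rewrite mulrBl mul1r mulrBr mulr1 idem_mul subrr subr0. Qed.

Definition idem_compl := IdemElt idem_compl_mul.

End Complement.

Section PrincipalModules.
Variables (R : pzRingType) (e : R).

Definition principal_pred : {pred (R^c)^o} :=
  [pred x | `[< exists a : R, x = e * a >]].

Lemma principal_closed : submod_closed principal_pred.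
Proof.
split=> [|b u v /asboolP[a ->] /asboolP[c ->]]; apply/asboolP.
  by exists 0; rewrite mulr0.
by exists (a * (b : R) + c); rewrite mulrDr mulrA.
Qed.

HB.instance Definition _ := GRing.isSubmodClosed.Build (R^c) (R^c)^o
  principal_pred principal_closed.

Definition eR : rmodType R := submod (principal_pred : submodClosed (R^c)^o).

Definition erad_pred : {pred eR} :=
  [pred x : eR | `[< exists2 r : R, r \in jacobson R & submod_val x = e * r >]].

Lemma erad_closed : submod_closed erad_pred.
Proof.
split=> [|b u v /asboolP[a aJ ua] /asboolP[c cJ vc]]; apply/asboolP.
  by exists 0; rewrite ?rpred0 ?mulr0.
exists (a * (b : R) + c); first by rewrite rpredD // jacobsonMr.
by rewrite mulrDr mulrA -ua -vc.
Qed.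

HB.instance Definition _ := GRing.isSubmodClosed.Build (R^c) eR
  erad_pred erad_closed.

(* eR / e rad R *)
Definition top_eR : rmodType R := quotmod (erad_pred : submodClosed eR).

End PrincipalModules.
Arguments principal_pred {R} e x.
Arguments erad_pred {R} e x.

Section Corner.
Variables (R : pzRingType) (f : idem_elt R).

(* fRf has unit f, so it is not a subring of R; it is the zero ring if f = 0. *)
Definition corner_pred : {pred R} :=
  [pred x | `[< exists a : R, x = (f : R) * a * (f : R) >]].

Lemma corner_zmod_closed : zmod_closed corner_pred.
Proof.
split=> [|x y /asboolP[a ->] /asboolP[b ->]]; apply/asboolP.
  by exists 0; rewrite mulr0 mul0r.
by exists (a - b); rewrite mulrBr mulrBl.
Qed.

HB.instance Definition _ := GRing.isZmodClosed.Build R corner_pred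
  corner_zmod_closed.

Record corner : Type := Corner {
  corner_val : R;
  _ : corner_val \in corner_pred
}.

HB.instance Definition _ := [isSub for corner_val].
HB.instance Definition _ := [Choice of corner by <:].
HB.instance Definition _ := [SubChoice_isSubZmodule of corner by <:].

Lemma corner1_subproof : (f : R) \in corner_pred.
Proof. by apply/asboolP; exists 1; rewrite mulr1 idem_mul. Qed.

Lemma corner_mul_subproof (x y : corner) :
  corner_val x * corner_val y \in corner_pred.
Proof.
have [/asboolP[a /= ->] /asboolP[b /= ->]] := (valP x, valP y); apply/asboolP.
by exists (a * (f : R) * (f : R) * b); rewrite !mulrA.
Qed.

Definition corner1 := Corner corner1_subproof.
Definition corner_mul (x y : corner) := Corner (corner_mul_subproof x y).

Lemma corner_valMl (x : corner) : (f : R) * corner_val x = corner_val x.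
Proof. by have /asboolP[a /= ->] := valP x; rewrite !mulrA idem_mul. Qed.

Lemma corner_valMr (x : corner) : corner_val x * (f : R) = corner_val x.
Proof. by have /asboolP[a /= ->] := valP x; rewrite -!mulrA idem_mul. Qed.

Lemma corner_mulA : associative corner_mul.
Proof. by move=> x y z; apply: val_inj; rewrite /= mulrA. Qed.

Lemma corner_mul1l : left_id corner1 corner_mul.
Proof. by move=> x; apply: val_inj; rewrite /= corner_valMl. Qed.

Lemma corner_mul1r : right_id corner1 corner_mul.
Proof. by move=> x; apply: val_inj; rewrite /= corner_valMr. Qed.

Lemma corner_mulDl : left_distributive corner_mul +%R.
Proof. by move=> x y z; apply: val_inj; rewrite /= mulrDl. Qed.

Lemma corner_mulDr : right_distributive corner_mul +%R.
Proof. by move=> x y z; apply: val_inj; rewrite /= mulrDr. Qed.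

HB.instance Definition _ := GRing.Zmodule_isPzRing.Build corner
  corner_mulA corner_mul1l corner_mul1r corner_mulDl corner_mulDr.

Lemma corner_lmul_subproof (g : corner) (x : eR f) :
  ((corner_val g * (submod_val x : R) : R) : (R^c)^o) \in principal_pred f.
Proof.
apply/asboolP; exists (corner_val g * (submod_val x : R)).
by rewrite mulrA corner_valMl.
Qed.

Definition corner_lmul (g : corner) (x : eR f) : eR f :=
  Submod (corner_lmul_subproof g x).

Lemma corner_lmul_is_linear g : linear (corner_lmul g).
Proof.
by move=> a x y; apply: val_inj; rewrite /= mulrDr mulrA.
Qed.

HB.instance Definition _ g := GRing.isLinear.Build (R^c) (eR f) (eR f) _
  (corner_lmul g) (corner_lmul_is_linear g).

Section Hom.
Variable M : rmodType R.

(* Hom_R(fR, M), a right fRf-module via (phi . g)(x) = phi (g x). *)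
Definition corner_hom : Type := {linear eR f -> M}.

HB.instance Definition _ := gen_eqMixin corner_hom.
HB.instance Definition _ := gen_choiceMixin corner_hom.

Definition corner_hom_fun (phi : corner_hom) : {linear eR f -> M} := phi.

Lemma corner_homP (phi psi : corner_hom) :
  corner_hom_fun phi =1 corner_hom_fun psi -> phi = psi.
Proof.
case: phi psi => [phi [[p] [q]]] [psi [[p'] [q']]] /funext /= eqf.
case: psi / eqf p' q' => p' q'.
by rewrite (Prop_irrelevance p p') (Prop_irrelevance q q').
Qed.

Definition corner_hom0 : corner_hom := GRing.Linear.clone _ _ _ _ (\0) _.
Definition corner_hom_opp (phi : corner_hom) : corner_hom :=
  GRing.Linear.clone _ _ _ _ (\- corner_hom_fun phi) _.
Definition corner_hom_add (phi psi : corner_hom) : corner_hom :=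
  GRing.Linear.clone _ _ _ _ (corner_hom_fun phi \+ corner_hom_fun psi) _.
Definition corner_hom_scale (g : corner^c) (phi : corner_hom) : corner_hom :=
  GRing.Linear.clone _ _ _ _ (corner_hom_fun phi \o corner_lmul g) _.

Lemma corner_hom_addA : associative corner_hom_add.
Proof. by move=> p q r; apply: corner_homP => x /=; rewrite addrA. Qed.

Lemma corner_hom_addC : commutative corner_hom_add.
Proof. by move=> p q; apply: corner_homP => x /=; rewrite addrC. Qed.

Lemma corner_hom_add0 : left_id corner_hom0 corner_hom_add.
Proof. by move=> p; apply: corner_homP => x /=; rewrite add0r. Qed.

Lemma corner_hom_addN : left_inverse corner_hom0 corner_hom_opp corner_hom_add.
Proof. by move=> p; apply: corner_homP => x /=; rewrite addNr. Qed.

HB.instance Definition _ := GRing.isZmodule.Build corner_hom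
  corner_hom_addA corner_hom_addC corner_hom_add0 corner_hom_addN.

Lemma corner_hom_scaleA (g h : corner^c) phi :
  corner_hom_scale g (corner_hom_scale h phi) = corner_hom_scale (g * h) phi.
Proof.
apply: corner_homP => x /=; congr (corner_hom_fun phi _).
by apply: val_inj; rewrite /= mulrA.
Qed.

Lemma corner_hom_scale1 : left_id 1 corner_hom_scale.
Proof.
move=> phi; apply: corner_homP => x /=; congr (corner_hom_fun phi _).
apply: val_inj => /=; have /asboolP[a /= ->] := valP x.
by rewrite mulrA idem_mul.
Qed.

Lemma corner_hom_scaleDr : right_distributive corner_hom_scale +%R.
Proof. by move=> g p q; apply: corner_homP. Qed.

Lemma corner_hom_scaleDl phi : {morph corner_hom_scale^~ phi : g h / g + h}.
Proof.
move=> g h; apply: corner_homP => x /=; rewrite -raddfD.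
by congr (corner_hom_fun phi _); apply: val_inj; rewrite /= mulrDl.
Qed.

HB.instance Definition _ := GRing.Zmodule_isLmodule.Build (corner^c) corner_hom
  corner_hom_scaleA corner_hom_scale1 corner_hom_scaleDr corner_hom_scaleDl.

End Hom.
End Corner.

Section Homological.
Variable R : pzRingType.

Definition projective (P : lmodType R) :=
  forall (M N : lmodType R) (g : {linear M -> N}) (f : {linear P -> N}),
    (forall y, exists x, g x = y) ->
    exists h : {linear P -> M}, forall x, g (h x) = f x.

Record proj_resolution (M : lmodType R) := ProjResolution {
  res : nat -> lmodType R;
  res_diff : forall i, {linear res i.+1 -> res i};
  res_aug : {linear res 0 -> M};
  res_projective : forall i, projective (res i);
  res_aug_surj : forall y, exists x, res_aug x = y;
  res_exact0 : forall x, res_aug x = 0 <-> exists y, res_diff 0 y = x;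
  res_exactS : forall i x,
    res_diff i x = 0 <-> exists y, res_diff i.+1 y = x
}.

Definition pd_finite (M : lmodType R) :=
  exists (n : nat) (P : proj_resolution M),
    forall i, (n < i)%N -> forall x : res P i, x = 0.

Definition cocycle (M N : lmodType R) (P : proj_resolution M) i
    (f : {linear res P i -> N}) :=
  forall x, f (res_diff P i x) = 0.

Definition coboundary (M N : lmodType R) (P : proj_resolution M) i :
    {linear res P i -> N} -> Prop :=
  if i is j.+1 then
    fun f => exists g : {linear res P j -> N}, forall x, f x = g (res_diff P j x)
  else fun f => forall x, f x = 0.

(* Ext^i_R(M, N) = 0: the i-th cohomology of Hom(P, N) vanishes for every
   projective resolution P of M.  Projective resolutions exist, and the
   cohomology does not depend on P. *)
Definition Ext_zero i (M N : lmodType R) :=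
  forall (P : proj_resolution M) (f : {linear res P i -> N}),
    cocycle f -> coboundary f.

Definition self_orthogonal (M : lmodType R) :=
  forall i, (0 < i)%N -> Ext_zero i M M.

End Homological.

(* Main.v *)
Require Import Defs.
From HB Require Import structures.
From mathcomp Require Import all_boot all_order all_algebra.
From mathcomp Require Import boolp functions.
From mathcomp Require classical_sets.

(** Write [J] for the radical, [f = 1 - e], [G = fAf] and [S = eA/eJ].

    Since [A] is basic and [e] is primitive, [eAf] lies in [J], and right
    multiplication by an element of [A] on a module killed by [J] and by [f] is
    either zero or invertible ([primitive_basic]); such a module is therefore
    semisimple, and a retract of a direct sum of copies of [S].  The hypothesis
    [Ext^1(S, S) = 0] says that no simple quotient of [eJ] is isomorphic to
    [S]; as [A] is Noetherian, every module killed by [f] is then killed by [J]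
    ([complement_killed_radical]).

    Let [P] be a finite projective resolution of [Hom_A(fA, eA) = eAf] over
    [G].  Tensoring it with [fA] over [G] and composing with [eAf (x) fA -> eA]
    gives a bounded complex [C : ... -> Q_1 -> Q_0 -> eA] of projective
    [A]-modules with [Hom(Q_i, S) = 0].  Its zeroth homology is [S].  Applying
    [(-) f] recovers the exact sequence [... -> P_1 -> P_0 -> eAf -> 0], so that
    the homology of [C] is killed by [f], hence is a retract of sums of copies
    of [S].

    Suppose that [Ext^j(S, S)] vanishes for all [j > m], where [m > 0].  The
    short exact sequences linking the boundaries, cycles and homology of [C]
    show, going up from degree zero, that [Ext^j] from every module of
    boundaries to [S] vanishes for [j >= m].  If [Ext^m(S, S)] were not zero,
    then going down from the top of [C] the homology would vanish in each
    positive degree, because a nonzero homology module has [S] as a retract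
    while its [Ext^m] to [S] is caught between two zero groups; at the same time
    [Ext^j] from the boundaries to [S] would vanish for all [j].  In degree zero
    this contradicts [Ext^m(S, S) <> 0] ([top_Ext_descend]).  Because [pd S] is
    finite, the vanishing range can thus be extended from [j > pd S] down to
    [j > 0].

    The long exact sequence of [Ext] is only used through the vanishing of one
    group between two others.  It comes from the fact that the mapping cone of a
    comparison map resolves the cokernel of an injection ([cone_resolution]). *)

Set Implicit Arguments.
Unset Strict Implicit.
Unset Printing Implicit Defensive.

Import GRing.Theory.
Local Open Scope ring_scope.

(** * Linear maps defined by their graphs *)

Section Graphs.
Variable R : pzRingType.
Implicit Types M N W X Y Z : lmodType R.

(** A function with a proof of its linearity, as a linear map. *)
Definition mk_linear M N (g : M -> N) (lin_g : linear g) : {linear M -> N} :=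
  HB.pack g (GRing.isLinear.Build R M N _ g lin_g).

(** A linear relation that is total and single-valued is the graph of a linear
    map. *)
Lemma linear_of_graph M N (G : M -> N -> Prop) :
    (forall x, exists y, G x y) -> (forall y, G 0 y -> y = 0) ->
    (forall a x y x' y', G x y -> G x' y' -> G (a *: x + x') (a *: y + y')) ->
  exists g : {linear M -> N}, forall x, G x (g x).
Proof.
move=> totG funG linG; have [g gG] := choice totG.
have uniqG x y y' : G x y -> G x y' -> y = y'.
  move=> Gy Gy'; apply/eqP; rewrite -subr_eq0; apply/eqP; apply: funG.
  by have := linG (-1) _ _ _ _ Gy' Gy; rewrite !scaleN1r addNr addrC.
have lin_g : linear g by move=> a x y; apply: uniqG (gG _) _; apply: linG.
by exists (mk_linear lin_g) => x; apply: gG.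
Qed.

Lemma factor_surj W Y N (s : {linear W -> Y}) (t : {linear W -> N}) :
    (forall y, exists w, s w = y) -> (forall w, s w = 0 -> t w = 0) ->
  exists g : {linear Y -> N}, forall w, g (s w) = t w.
Proof.
move=> surj_s ker_st.
have [|||g gP] := @linear_of_graph _ _
  (fun y n => exists2 w, s w = y & t w = n).
- by move=> y; have [w sw] := surj_s y; exists (t w), w.
- by move=> n [w /ker_st tw <-].
- move=> a x y x' y' [w <- <-] [w' <- <-].
  by exists (a *: w + w'); rewrite linearP.
exists g => w; have [w' ss <-] := gP (s w).
apply/eqP; rewrite -subr_eq0 -linearB; apply/eqP; apply: ker_st.
by rewrite linearB /= ss subrr.
Qed.

Lemma lift_inj Z X Y (i : {linear X -> Y}) (g : {linear Z -> Y}) :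
    (forall x, i x = 0 -> x = 0) -> (forall z, exists x, i x = g z) ->
  exists h : {linear Z -> X}, forall z, i (h z) = g z.
Proof.
move=> inj_i im_g.
have [//|y|a x y x' y' iy iy'|h hP] :=
  @linear_of_graph _ _ (fun z x => i x = g z).
- by rewrite linear0; apply: inj_i.
- by rewrite !linearP iy iy'.
by exists h.
Qed.

End Graphs.

(** Dependent choice along a sequence of types, with an invariant [J] that
    allows the construction to proceed. *)
Lemma dependent_choice_seq (T : nat -> Type) (J : forall i, T i -> Prop)
    (step : forall i, T i -> T i.+1 -> Prop) (x0 : T 0%N) :
    J 0%N x0 ->
    (forall i (x : T i), J i x -> exists2 y : T i.+1, step i x y & J i.+1 y) ->
  exists s : forall i, T i,
    s 0%N = x0 /\ forall i, step i (s i) (s i.+1).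
Proof.
move=> J0 next.
have {}next i (x : {x : T i | J i x}) :
    exists y : {y : T i.+1 | J i.+1 y}, step i (sval x) (sval y).
  by case: x => x Jx /=; have [y xy Jy] := next i x Jx; exists (exist _ y Jy).
pose s := fix s i : {x : T i | J i x} :=
  if i is j.+1 then sval (cid (next j (s j))) else exist _ x0 J0.
exists (fun i => sval (s i)); split=> // i.
exact: (svalP (cid (next i (s i)))).
Qed.

(** * Submodules, kernels, images and quotients *)

Section Submods.
Variable R : pzRingType.
Implicit Types M N X Y Z : lmodType R.

(** A predicate with a proof that it is a submodule, as a structure. *)
Definition mk_submod M (S : {pred M}) (cS : submod_closed S) : submodClosed M :=
  HB.pack S (GRing.isSubmodClosed.Build R M S cS).

(** The submodule [S], as a module, with its inclusion. *)
Lemma submodule_exists M (S : {pred M}) : submod_closed S ->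
  exists (X : lmodType R) (i : {linear X -> M}),
    (forall x, i x = 0 -> x = 0) /\ (forall y, y \in S <-> exists x, i x = y).
Proof.
move=> cS; pose U : submodClosed M := mk_submod cS.
exists (submod U : lmodType R).
have lin_i : linear (fun x : submod U => submod_val x) by [].
exists (mk_linear lin_i); split=> [x x0|y]; first exact: val_inj.
split=> [yS|[x <-]]; last exact: valP x.
by exists (@Submod R M U y yS).
Qed.

Lemma quotient_exists M (S : {pred M}) : submod_closed S ->
  exists (X : lmodType R) (p : {linear M -> X}),
    (forall x, exists y, p y = x) /\ (forall y, y \in S <-> p y = 0).
Proof.
move=> cS; pose U : submodClosed M := mk_submod cS.
exists (quotmod U : lmodType R), (quotmod_proj U : {linear M -> quotmod U}).
split=> [x|y]; first by eexists; apply: quotmod_projK.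
have -> : (y \in S) = (quotmod_proj U y == quotmod_proj U 0).
  by rewrite quotmod_projP subr0.
by split=> [/eqP|->]; rewrite linear0.
Qed.

Lemma kernel_closed M N (g : {linear M -> N}) :
  submod_closed [pred x | `[< g x = 0 >]].
Proof.
split=> [|a x y /asboolP gx /asboolP gy]; apply/asboolP.
  by rewrite linear0.
by rewrite linearP gx gy scaler0 addr0.
Qed.

Lemma image_closed M N (g : {linear M -> N}) :
  submod_closed [pred y | `[< exists x, g x = y >]].
Proof.
split=> [|a _ _ /asboolP[x <-] /asboolP[y <-]]; apply/asboolP.
  by exists 0; rewrite linear0.
by exists (a *: x + y); rewrite linearP.
Qed.

End Submods.

Section ShortExact.
Variable R : pzRingType.
Implicit Types M N X Y Z : lmodType R.

(** [0 -> X -> Y -> Z -> 0] is exact. *)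
Definition short_exact X Y Z (i : {linear X -> Y}) (p : {linear Y -> Z}) :=
  [/\ forall x, i x = 0 -> x = 0, forall z, exists y, p y = z
    & forall y, p y = 0 <-> exists x, i x = y].

Lemma kernel_exists M N (g : {linear M -> N}) :
  exists (X : lmodType R) (i : {linear X -> M}),
    (forall x, i x = 0 -> x = 0) /\ (forall y, g y = 0 <-> exists x, i x = y).
Proof.
have [X [i [inj_i im_i]]] := submodule_exists (kernel_closed g).
exists X, i; split=> // y.
by split=> [gy|/im_i/asboolP //]; apply/im_i/asboolP.
Qed.

Lemma cokernel_exists M N (g : {linear M -> N}) :
  exists (X : lmodType R) (p : {linear N -> X}),
    (forall x, exists y, p y = x) /\ (forall y, p y = 0 <-> exists x, g x = y).
Proof.
have [X [p [surj_p ker_p]]] := quotient_exists (image_closed g).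
exists X, p; split=> // y.
by split=> [/ker_p/asboolP //|gy]; apply/ker_p/asboolP.
Qed.

End ShortExact.

(** * Direct sums of copies of a module *)

Section DirectSums.
Variables (R : pzRingType) (I : choiceType) (V : lmodType R).

Definition finite_support_pred : {pred I -> V} :=
  [pred g | `[< exists s : seq I, forall i, i \notin s -> g i = 0 >]].

Lemma finite_support_closed : submod_closed finite_support_pred.
Proof.
split=> [|a g h /asboolP[s gs] /asboolP[t ht]]; apply/asboolP.
  by exists [::].
exists (s ++ t) => i; rewrite mem_cat negb_or => /andP[/gs gi /ht hi].
by rewrite addrfctE scalrfctE gi hi scaler0 addr0.
Qed.

(** The direct sum of copies of [V] indexed by [I]: the functions from [I] to
    [V] with finite support. *)
Definition dsum : lmodType R := submod (mk_submod finite_support_closed).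

(** The projection onto the summand of index [i]. *)
Definition dsum_proj (i : I) (x : dsum) : V := submod_val x i.

Lemma dsum_projP (x y : dsum) :
  (forall i, dsum_proj i x = dsum_proj i y) -> x = y.
Proof. by move=> xy; apply: val_inj; apply/funext. Qed.

Lemma dsum_proj_is_linear i : linear (dsum_proj i).
Proof. by []. Qed.

HB.instance Definition _ i :=
  GRing.isLinear.Build R dsum V _ (dsum_proj i) (dsum_proj_is_linear i).

Lemma finite_supportP (g : I -> V) (s : seq I) :
  (forall i, i \notin s -> g i = 0) -> g \in mk_submod finite_support_closed.
Proof. by move=> gs; apply/asboolP; exists s. Qed.

Lemma dsum_inj_subproof i (v : V) :
  (fun j => if j == i then v else 0) \in mk_submod finite_support_closed.
Proof. by apply: (@finite_supportP _ [:: i]) => j; rewrite inE => /negPf->. Qed.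

(** The inclusion of the summand of index [i]. *)
Definition dsum_inj i (v : V) : dsum := Submod (dsum_inj_subproof i v).

Arguments dsum_proj : simpl never.
Arguments dsum_inj : simpl never.

Lemma dsum_proj_inj i j v :
  dsum_proj j (dsum_inj i v) = if j == i then v else 0.
Proof. by []. Qed.

Lemma dsum_inj_is_linear i : linear (dsum_inj i).
Proof.
move=> a u v; apply: dsum_projP => j; rewrite linearP /= !dsum_proj_inj.
by case: ifP => // _; rewrite scaler0 addr0.
Qed.

HB.instance Definition _ i :=
  GRing.isLinear.Build R V dsum _ (dsum_inj i) (dsum_inj_is_linear i).

Lemma dsum_support (x : dsum) :
  exists2 s : seq I, uniq s & forall i, i \notin s -> dsum_proj i x = 0.
Proof.
have /asboolP[s xs] := valP x; exists (undup s); first exact: undup_uniq.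
by move=> i; rewrite mem_undup; apply: xs.
Qed.

Lemma dsum_sum_inj (x : dsum) (s : seq I) :
    uniq s -> (forall i, i \notin s -> dsum_proj i x = 0) ->
  x = \sum_(i <- s) dsum_inj i (dsum_proj i x).
Proof.
move=> us xs; apply: dsum_projP => j; rewrite linear_sum /=.
under eq_bigr do rewrite dsum_proj_inj.
have [js|js] := boolP (j \in s); last first.
  rewrite xs // big_seq big1 // => i si.
  by case: eqP => // ji; rewrite ji si in js.
rewrite (bigD1_seq j) //= eqxx big1 ?addr0 // => i /negPf.
by rewrite eq_sym => ->.
Qed.

Lemma dsum_ind (P : dsum -> Prop) :
    P 0 -> (forall x y, P x -> P y -> P (x + y)) ->
    (forall i v, P (dsum_inj i v)) ->
  forall x, P x.
Proof.
move=> P0 PD Pi x; have [s us xs] := dsum_support x.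
by rewrite (dsum_sum_inj us xs); elim/big_ind: _.
Qed.

(** Additive maps on the summands extend to the direct sum; the target need not
    be a module over [R]. *)
Lemma dsum_additive_ext (W : zmodType) (u : I -> V -> W) :
    (forall i v w, u i (v + w) = u i v + u i w) ->
  exists F : dsum -> W, (forall x y, F (x + y) = F x + F y) /\
    forall i v, F (dsum_inj i v) = u i v.
Proof.
move=> uD; have u0 i : u i 0 = 0.
  by apply: (addrI (u i 0)); rewrite -uD !addr0.
have /choice[s sP] (x : dsum) : exists s : seq I,
    uniq s /\ forall i, i \notin s -> dsum_proj i x = 0.
  by have [s us xs] := dsum_support x; exists s.
pose F x := \sum_(i <- s x) u i (dsum_proj i x).
(* The sum does not depend on the finite set that contains the support. *)
have FE x (t : seq I) : uniq t -> (forall i, i \notin t -> dsum_proj i x = 0) ->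
    F x = \sum_(i <- t) u i (dsum_proj i x).
  have [us xs] := sP x => ut xt; rewrite /F.
  rewrite [LHS](bigID (mem t)) [RHS](bigID (mem (s x))) /=.
  rewrite [X in _ + X]big1 ?addr0; last by move=> i /xt->.
  rewrite [X in _ = _ + X]big1 ?addr0; last by move=> i /xs->.
  rewrite -[LHS]big_filter -[RHS]big_filter; apply: perm_big.
  apply: uniq_perm; rewrite ?filter_uniq // => i.
  by rewrite !mem_filter andbC.
exists F; split=> [x y|i v].
  pose t := undup (s x ++ s y).
  have tP z : z = x \/ z = y -> forall i, i \notin t -> dsum_proj i z = 0.
    move=> xyz i; rewrite mem_undup mem_cat negb_or => /andP[six siy].
    by case: xyz => ->; [apply: (sP x).2 | apply: (sP y).2].
  have ut : uniq t by apply: undup_uniq.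
  rewrite (FE x t) ?(FE y t) ?(FE (x + y) t) //; try by apply: tP; auto.
    by rewrite -big_split; apply: eq_bigr => i _; rewrite linearD uD.
  move=> i ti; rewrite linearD /=.
  by rewrite !(tP _ _ i ti) ?addr0 //; [right | left].
rewrite (FE _ [:: i]) ?big_seq1 ?dsum_proj_inj ?eqxx // => j.
by rewrite inE => /negPf ji; rewrite dsum_proj_inj ji.
Qed.

(** The universal property of the direct sum. *)
Lemma dsum_linear_ext (W : lmodType R) (u : I -> {linear V -> W}) :
  exists F : {linear dsum -> W}, forall i v, F (dsum_inj i v) = u i v.
Proof.
have [i v w|F [FD Fi]] := @dsum_additive_ext W u; first by rewrite linearD.
have F0 : F 0 = 0 by apply: (addrI (F 0)); rewrite -FD !addr0.
have lin_F : linear F.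
  move=> a x y; rewrite FD; congr (_ + _); move: x.
  apply: dsum_ind => [|x z Fx Fz|i v]; first by rewrite scaler0 F0 scaler0.
    by rewrite scalerDr !FD Fx Fz scalerDr.
  by rewrite -linearZ !Fi linearZ.
by exists (mk_linear lin_F).
Qed.

End DirectSums.
Arguments dsum_proj : simpl never.
Arguments dsum_inj : simpl never.

(** * Projective modules *)

Section Projectives.
Variable R : pzRingType.
Implicit Types M N P X Y Z : lmodType R.

Lemma projective_dsum (I : choiceType) P :
  projective P -> projective (dsum I P).
Proof.
move=> projP M N g f surj_g.
have /choice[h hP] i := projP M N g (f \o @dsum_inj R I P i) surj_g.
have [F Fi] := dsum_linear_ext h; exists F; apply: dsum_ind.
- by rewrite !linear0.
- by move=> x y Fx Fy; rewrite !linearD Fx Fy.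
- by move=> i v; rewrite Fi hP.
Qed.

Lemma projective_regular : projective R^o.
Proof.
move=> M N g f surj_g; have [x gx] := surj_g (f 1).
have lin_h : linear (fun a : R^o => (a : R) *: x).
  by move=> a b c; rewrite scalerDl scalerA.
exists (mk_linear lin_h) => a.
by rewrite [LHS](linearZ_LR g) gx -linearZ_LR; congr (f _); apply: mulr1.
Qed.

(** Every module is a quotient of the free module on its own elements. *)
Lemma projective_cover X :
  exists (P : lmodType R) (p : {linear P -> X}),
    projective P /\ forall x, exists y, p y = x.
Proof.
have lin_u (x : X) : linear (fun a : R^o => (a : R) *: x).
  by move=> a b c; rewrite scalerDl scalerA.
have [p pP] := @dsum_linear_ext R X R^o X (fun x => mk_linear (lin_u x)).
exists (dsum X R^o), p; split.
  by apply: projective_dsum projective_regular.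
by move=> x; exists (dsum_inj x (1 : R^o)); rewrite pP /= scale1r.
Qed.

Lemma proj_resolution_exists X : inhabited (proj_resolution X).
Proof.
have cover Y : exists t : {P : lmodType R & {linear P -> Y}},
    projective (tag t) /\ forall y, exists x, tagged t x = y.
  have [P [p Pp]] := projective_cover Y.
  by exists (existT (fun P : lmodType R => {linear P -> Y}) P p).
pose P Y := tag (sval (cid (cover Y))).
pose p Y : {linear P Y -> Y} := tagged (sval (cid (cover Y))).
have projP Y : projective (P Y) := (svalP (cid (cover Y))).1.
have surj_p Y : forall y, exists x, p Y x = y := (svalP (cid (cover Y))).2.
have kernel Y : exists t : {K : lmodType R & {linear K -> P Y}},
    (forall x, tagged t x = 0 -> x = 0) /\
    (forall y, p Y y = 0 <-> exists x, tagged t x = y).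
  have [K [i Ki]] := kernel_exists (p Y).
  by exists (existT (fun K : lmodType R => {linear K -> P Y}) K i).
pose K Y := tag (sval (cid (kernel Y))).
pose k Y : {linear K Y -> P Y} := tagged (sval (cid (kernel Y))).
have inj_k Y : forall x, k Y x = 0 -> x = 0 := (svalP (cid (kernel Y))).1.
have ker_p Y : forall y, p Y y = 0 <-> exists x, k Y x = y :=
  (svalP (cid (kernel Y))).2.
(* [T i] is the i-th syzygy of [X]. *)
pose T := fix T i := if i is j.+1 then K (T j) else X.
pose d i : {linear P (T i.+1) -> P (T i)} := k (T i) \o p (T i.+1).
split; apply: (@ProjResolution R X (fun i => P (T i)) d (p X)) => //.
- move=> x; split=> [/ker_p[z <-]|[y <-]]; last by apply/ker_p; eexists.
  by have [y <-] := surj_p _ z; exists y.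
- move=> i x; split=> [/inj_k/ker_p[z <-]|[y <-] /=].
    by have [y <-] := surj_p _ z; exists y.
  by rewrite (_ : p _ _ = 0) ?linear0 //; apply/ker_p; eexists.
Qed.

End Projectives.

(** * Comparison of projective resolutions *)

Section Comparison.
Variable R : pzRingType.
Implicit Types M N W X Y Z : lmodType R.

(** Lifting along [g] when only the image of [f] is known to be covered. *)
Lemma projective_lift M N (P : lmodType R) (g : {linear M -> N})
    (f : {linear P -> N}) :
    projective P -> (forall x, exists y, g y = f x) ->
  exists h : {linear P -> M}, forall x, g (h x) = f x.
Proof.
move=> projP im_f.
have [X [i [inj_i im_i]]] := submodule_exists (image_closed g).
have [|g' g'P] := lift_inj inj_i (g := g).
  by move=> y; apply/im_i/asboolP; exists y.
have [|f' f'P] := lift_inj inj_i (g := f).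
  by move=> x; have [y gy] := im_f x; apply/im_i/asboolP; exists y.
have [|h hP] := projP M X g' f'.
  move=> x; have /im_i/asboolP[y gy] : exists x', i x' = i x by exists x.
  exists y; apply/eqP; rewrite -subr_eq0; apply/eqP/inj_i.
  by rewrite linearB /= g'P gy subrr.
by exists h => x; rewrite -g'P hP f'P.
Qed.

Lemma res_diffK X (P : proj_resolution X) i x :
  res_diff P i (res_diff P i.+1 x) = 0.
Proof. by apply/res_exactS; exists x. Qed.

Lemma res_augK X (P : proj_resolution X) x : res_aug P (res_diff P 0 x) = 0.
Proof. by apply/res_exact0; exists x. Qed.

(** A map between modules lifts to a chain map between resolutions. *)
Lemma comparison X Y (P : proj_resolution X) (Q : proj_resolution Y)
    (u : {linear X -> Y}) :
  exists phi : forall i, {linear res P i -> res Q i},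
    (forall x, res_aug Q (phi 0 x) = u (res_aug P x)) /\
    (forall i x, res_diff Q i (phi i.+1 x) = phi i (res_diff P i x)).
Proof.
have [|phi0 phi0P] := projective_lift (g := res_aug Q) (f := u \o res_aug P)
  (@res_projective _ _ P 0).
  by move=> x; apply: res_aug_surj.
have [||phi [phi0E phiP]] := @dependent_choice_seq
  (fun i => {linear res P i -> res Q i})
  (fun i f => forall x, exists y, res_diff Q i y = f (res_diff P i x))
  (fun i f g => forall x, res_diff Q i (g x) = f (res_diff P i x)) phi0.
- by move=> x; apply/res_exact0; rewrite phi0P /= res_augK linear0.
- move=> i f fP.
  have [g gP] := projective_lift (f := f \o res_diff P i)
    (@res_projective _ _ P i.+1) fP.
  exists g => // x; apply/res_exactS.
  by rewrite gP /= res_diffK linear0.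
by exists phi; rewrite phi0E.
Qed.

(** A chain map [t] between resolutions that lifts the zero map is
    null-homotopic. *)
Lemma null_homotopy X Y (P : proj_resolution X) (Q : proj_resolution Y)
    (t : forall i, {linear res P i -> res Q i}) :
    (forall x, res_aug Q (t 0 x) = 0) ->
    (forall i x, res_diff Q i (t i.+1 x) = t i (res_diff P i x)) ->
  exists h : forall i, {linear res P i -> res Q i.+1},
    (forall x, res_diff Q 0 (h 0 x) = t 0 x) /\
    (forall i x, res_diff Q i.+1 (h i.+1 x) + h i (res_diff P i x) = t i.+1 x).
Proof.
move=> t0 tP.
have [|h0 h0P] := projective_lift (g := res_diff Q 0) (f := t 0)
  (@res_projective _ _ P 0).
  by move=> x; apply/res_exact0.
have [||h [h0E hP]] := @dependent_choice_seq
  (fun i => {linear res P i -> res Q i.+1})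
  (fun i h => forall x,
     res_diff Q i (h (res_diff P i x)) = t i (res_diff P i x))
  (fun i h k => forall x,
     res_diff Q i.+1 (k x) + h (res_diff P i x) = t i.+1 x) h0.
- by move=> x; rewrite h0P.
- move=> i h hP.
  have [|k kP] := projective_lift (g := res_diff Q i.+1)
    (f := t i.+1 \- (h \o res_diff P i)) (@res_projective _ _ P i.+1).
    by move=> x; apply/res_exactS; rewrite linearB /= tP hP subrr.
  exists k => x; first by rewrite kP /= subrK.
  by rewrite kP /= res_diffK linear0 subr0.
by exists h; rewrite h0E.
Qed.

(** Ext may be computed on a single resolution, and its vanishing passes to
    retracts. *)
Lemma Ext_zero_retract X Y N (i : {linear X -> Y}) (r : {linear Y -> X})
    (Q : proj_resolution Y) j :
    (forall x, r (i x) = x) ->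
    (forall f : {linear res Q j -> N}, cocycle f -> coboundary f) ->
  Ext_zero j X N.
Proof.
move=> riK QN P f cf.
have [phi [phi0 phiS]] := comparison P Q i.
have [psi [psi0 psiS]] := comparison Q P r.
have [||h [h0 hS]] := @null_homotopy X X P P (fun i => psi i \o phi i \- idfun).
- by move=> x; rewrite /= linearB /= psi0 phi0 riK subrr.
- by move=> l x; rewrite /= linearB /= psiS phiS.
have {}QN : coboundary (f \o psi j : {linear res Q j -> N}).
  by apply: QN => x; rewrite /= -psiS cf.
(* [psi \o phi - id] lifts the zero map of [X], hence is null-homotopic. *)
have fE x : f x = f (psi j (phi j x)) - f ((psi j \o phi j \- idfun) x).
  by rewrite -linearB /= opprB addrC subrK.
case: j => [|j] in f cf QN fE *.
  by move=> x; rewrite fE -h0 cf subr0; apply: QN.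
have [g gP] := QN.
exists (g \o phi j \- (f \o h j)) => x.
rewrite fE -hS linearD /= cf add0r.
by rewrite -phiS -[in RHS]gP.
Qed.

Lemma Ext_zero_of_res X N (Q : proj_resolution X) j :
  (forall f : {linear res Q j -> N}, cocycle f -> coboundary f) ->
  Ext_zero j X N.
Proof. exact: (@Ext_zero_retract X X N idfun idfun). Qed.

Lemma Ext_zero_retraction X Y N (i : {linear X -> Y}) (r : {linear Y -> X}) j :
  (forall x, r (i x) = x) -> Ext_zero j Y N -> Ext_zero j X N.
Proof.
move=> riK YN; have [Q] := proj_resolution_exists Y.
exact: (Ext_zero_retract (Q := Q) riK (YN Q)).
Qed.

Lemma Ext_zero0P X N :
  Ext_zero 0 X N <-> forall (f : {linear X -> N}) x, f x = 0.
Proof.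
split=> [XN f x|XN P f cf x].
  have [P] := proj_resolution_exists X.
  have [y <-] := res_aug_surj P x.
  apply: (XN P (f \o res_aug P)) => z.
  by rewrite /= res_augK linear0.
have [|g gP] := factor_surj (t := f) (res_aug_surj P); last by rewrite -gP XN.
by move=> w /res_exact0[y <-].
Qed.

Lemma Ext_zero_projective X N j : projective X -> Ext_zero j.+1 X N.
Proof.
move=> projX.
have zeroE (x : 'rV[R]_0) : x = 0 by apply/matrixP => ? [].
(* [X] is a resolution of itself, concentrated in degree zero. *)
pose T i : lmodType R := if i is _.+1 then 'rV[R]_0 else X.
pose d i : {linear T i.+1 -> T i} := \0.
have TS i (x : T i.+1) : x = 0 by apply: zeroE.
have @P : proj_resolution X.
  apply: (@ProjResolution R X T d idfun) => //.
  - case=> // i M L g f _; exists \0 => x.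
    by rewrite (TS i x) !linear0.
  - by move=> y; exists y.
  - by move=> x /=; split=> [->|[y <-]] //; exists 0.
  - by move=> i x; split=> // _; exists 0; rewrite (TS i x).
apply: (@Ext_zero_of_res X N P) => f _; exists \0 => x.
by rewrite (TS j x) linear0.
Qed.

End Comparison.

(** * The long exact sequence of Ext, through the mapping cone *)

Section Pairs.
Variables (R : pzRingType) (V W : lmodType R).

Lemma pair_left_is_linear : linear (fun x : V => (x, 0) : V * W).
Proof. by move=> a x y; congr (_, _); rewrite /= scaler0 addr0. Qed.

Lemma pair_right_is_linear : linear (fun y : W => (0, y) : V * W).
Proof. by move=> a x y; congr (_, _); rewrite /= scaler0 addr0. Qed.

Definition pair_left : {linear V -> (V * W)%type} :=
  mk_linear pair_left_is_linear.
Definition pair_right : {linear W -> (V * W)%type} :=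
  mk_linear pair_right_is_linear.

Lemma linear_pair (N : lmodType R) (f : {linear (V * W)%type -> N}) x y :
  f (x, y) = f (pair_left x) + f (pair_right y).
Proof. by rewrite -linearD; congr (f (_, _)); rewrite /= ?addr0 ?add0r. Qed.

End Pairs.

Section Cone.
Variable R : pzRingType.
Implicit Types N : lmodType R.

Lemma projective_prod (P Q : lmodType R) :
  projective P -> projective Q -> projective (P * Q)%type.
Proof.
move=> projP projQ M N g f surj_g.
have [h1 h1P] := projP M N g (f \o @pair_left R P Q) surj_g.
have [h2 h2P] := projQ M N g (f \o @pair_right R P Q) surj_g.
exists ((h1 \o fst) \+ (h2 \o snd)) => -[x y].
by rewrite linearD /= h1P h2P linear_pair.
Qed.

Variables (X Y Z : lmodType R) (i : {linear X -> Y}) (p : {linear Y -> Z}).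
Hypothesis ip_exact : short_exact i p.
Variables (P : proj_resolution X) (Q : proj_resolution Y).
Variable phi : forall j, {linear res P j -> res Q j}.
Hypothesis phi0 : forall x, res_aug Q (phi 0 x) = i (res_aug P x).
Hypothesis phiS :
  forall j x, res_diff Q j (phi j.+1 x) = phi j (res_diff P j x).

(** The mapping cone of [phi], which resolves the cokernel [Z] of [i].  Its
    differential is [(y, x) |-> (d y + phi x, - d x)]. *)
Definition cone j : lmodType R :=
  if j is l.+1 then (res Q l.+1 * res P l)%type else res Q 0.

Definition cone_diffS j (z : res Q j.+2 * res P j.+1) : res Q j.+1 * res P j :=
  (res_diff Q j.+1 z.1 + phi j.+1 z.2, - res_diff P j z.2).

Lemma cone_diffS_is_linear j : linear (@cone_diffS j).
Proof.
move=> a x y; rewrite /cone_diffS !linearP /=.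
by congr (_, _); rewrite /= scalerDr addrACA.
Qed.

Definition cone_diff j : {linear cone j.+1 -> cone j} :=
  match j return {linear cone j.+1 -> cone j} with
  | 0 => (res_diff Q 0 \o fst) \+ (phi 0 \o snd)
  | l.+1 => mk_linear (@cone_diffS_is_linear l)
  end.

Lemma cone_projective j : projective (cone j).
Proof.
case: j => [|j]; first exact: res_projective.
by apply: projective_prod; apply: res_projective.
Qed.

Lemma cone_exact0 x :
  (p \o res_aug Q) x = 0 <-> exists y, cone_diff 0 y = x.
Proof.
have [inj_i surj_p ker_p] := ip_exact.
split=> [/ker_p[x' ix']|[[y z] <-]] /=; last first.
  by rewrite linearD /= res_augK add0r phi0; apply/ker_p; eexists.
have [z zx'] := res_aug_surj P x'.
have /res_exact0[y yx] : res_aug Q (x - phi 0 z) = 0.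
  by rewrite linearB /= phi0 zx' ix' subrr.
by exists (y, z); rewrite /= yx subrK.
Qed.

Lemma cone_exactS j x :
  cone_diff j x = 0 <-> exists y, cone_diff j.+1 y = x.
Proof.
have [inj_i surj_p ker_p] := ip_exact.
suff [dd ex] : (forall z, cone_diff j (cone_diff j.+1 z) = 0) /\
    (forall x, cone_diff j x = 0 ->
      exists z y, res_diff P j z = x.2 /\ res_diff Q j.+1 y = x.1 + phi j.+1 z).
  split=> [/ex[z [y [zx yx]]]|[y <-]]; last exact: dd.
  exists (y, - z); case: x zx yx => x1 x2 /= zx yx.
  by rewrite /cone_diffS /= !linearN /= opprK zx yx addrK.
case: j {x} => [|j]; split.
- case=> y z /=; rewrite linearD linearN /= res_diffK add0r phiS.
  by rewrite subrr.
- case=> y x /= yx0.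
  have /res_exact0[z zx] : res_aug P x = 0.
    apply: inj_i; rewrite -phi0.
    have := congr1 (res_aug Q) yx0.
    by rewrite linear0 linearD /= res_augK add0r.
  have /res_exactS[y' y'E] : res_diff Q 0 (y + phi 1 z) = 0.
    by rewrite linearD /= phiS zx.
  by exists z, y'.
- case=> y z; rewrite /= /cone_diffS /= linearD !linearN /= !res_diffK.
  rewrite add0r phiS.
  by rewrite subrr !oppr0.
- case=> y x yx; have /= yx0 := congr1 fst yx.
  have /= /eqP := congr1 snd yx; rewrite oppr_eq0 => /eqP/res_exactS[z zx].
  have /res_exactS[y' y'E] : res_diff Q j.+1 (y + phi j.+2 z) = 0.
    by rewrite linearD /= phiS zx.
  by exists z, y'.
Qed.

Definition cone_resolution : proj_resolution Z.
Proof.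
apply: (@ProjResolution R Z cone cone_diff (p \o res_aug Q)).
- exact: cone_projective.
- have [_ surj_p _] := ip_exact.
  move=> z; have [y <-] := surj_p z; have [x <-] := res_aug_surj Q y.
  by exists x.
- exact: cone_exact0.
- exact: cone_exactS.
Defined.

End Cone.

Section LongExact.
Variable R : pzRingType.
Variables (X Y Z N : lmodType R) (i : {linear X -> Y}) (p : {linear Y -> Z}).
Hypothesis ip_exact : short_exact i p.

(** Exactness at [Ext^j(X, N)]. *)
Lemma Ext_zero_sub j : Ext_zero j Y N -> Ext_zero j.+1 Z N -> Ext_zero j X N.
Proof.
move=> YN ZN P f cf.
have [Q] := proj_resolution_exists Y.
have [phi [phi0 phiS]] := comparison P Q i.
pose C := cone_resolution ip_exact phi0 phiS.
(* A cocycle on [P] becomes a cocycle of the cone, one degree higher. *)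
have [x|g gP] := ZN C (f \o snd : {linear (res Q j.+1 * res P j)%type -> N}).
  by rewrite /= linearN cf oppr0.
case: j => [|j] in f cf YN ZN g gP *.
  have g0 : g =1 \0.
    apply: (YN Q g) => y; have /= := gP (y, 0).
    by rewrite !linear0 addr0 => <-.
  by move=> x; rewrite [LHS](gP (0, x)) g0.
have [y|h hP] := YN Q (g \o @pair_left _ (res Q j.+1) (res P j)).
  have /= := gP (y, 0); rewrite /cone_diffS /= !linear0 addr0.
  by move=> <-.
exists (h \o phi j \- (g \o @pair_right _ (res Q j.+1) (res P j))) => x.
rewrite [LHS](gP (0, x)) /= /cone_diffS /= linear0 add0r.
rewrite -phiS -hP /= -linearB /=; congr (g (_, _)).
  by rewrite /= subr0.
by rewrite /= sub0r.
Qed.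

(** Exactness at [Ext^(j+1)(Z, N)]. *)
Lemma Ext_zero_quo j : Ext_zero j X N -> Ext_zero j.+1 Y N -> Ext_zero j.+1 Z N.
Proof.
move=> XN YN.
have [P] := proj_resolution_exists X.
have [Q] := proj_resolution_exists Y.
have [phi [phi0 phiS]] := comparison P Q i.
apply: (@Ext_zero_of_res _ _ _ (cone_resolution ip_exact phi0 phiS)) => f cf.
pose f1 : {linear res Q j.+1 -> N} := f \o @pair_left _ (res Q j.+1) (res P j).
pose f2 : {linear res P j -> N} := f \o @pair_right _ (res Q j.+1) (res P j).
have fE y x : f (y, x) = f1 y + f2 x by apply: linear_pair.
have [y|g gP] := YN Q f1.
  have := cf (y, 0); rewrite /= /cone_diffS /= !linear0 addr0.
  exact.
(* After subtracting the coboundary of [g], the cocycle [f] lives on [P]. *)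
have cg : cocycle (f2 \- (g \o phi j) : {linear res P j -> N}).
  move=> x; have := cf (0, x); rewrite /= /cone_diffS /= linear0 add0r fE.
  rewrite gP phiS linearN => /eqP; rewrite subr_eq0 => /eqP gx.
  by apply/eqP; rewrite /= subr_eq0 gx.
have := XN P _ cg.
case: j => [|j] in phi phi0 phiS f cf f1 f2 fE g gP cg XN YN *.
  move=> f2E; exists g => -[y x].
  have := f2E x => /eqP; rewrite /= subr_eq0 => /eqP f2x.
  by rewrite fE gP linearD [f2 x]f2x.
move=> [h hP]; exists ((g \o fst) \- (h \o snd)) => -[y x].
rewrite fE gP /= linearD linearN opprK -hP /=.
by rewrite -addrA [X in _ = _ + X]addrC subrK.
Qed.

End LongExact.

Section ExtConsequences.
Variable R : pzRingType.

(** [Y] is the cokernel of a map [res P 1 -> res P 0 x X], which gives the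
    extension [h] by the universal property. *)
Lemma Ext_zero1_extend (X Y Z N : lmodType R) (i : {linear X -> Y})
    (p : {linear Y -> Z}) (f : {linear X -> N}) :
    short_exact i p -> Ext_zero 1 Z N ->
  exists g : {linear Y -> N}, forall x, g (i x) = f x.
Proof.
move=> [inj_i surj_p ker_p] ZN; have [P] := proj_resolution_exists Z.
have [|u uP] := projective_lift (g := p) (f := res_aug P)
  (@res_projective _ _ P 0).
  by move=> x; apply: surj_p.
have [|v vP] := projective_lift (g := i) (f := u \o res_diff P 0)
  (@res_projective _ _ P 1).
  by move=> x; apply/ker_p; rewrite uP res_augK.
have [x|g gP] := ZN P (f \o v).
  rewrite /= (_ : v _ = 0) ?linear0 //; apply: inj_i.
  by rewrite vP /= res_diffK linear0.
have [||h hP] := @factor_surj _ (res P 0 * X)%type Y N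
    ((u \o fst) \+ (i \o snd)) ((g \o fst) \+ (f \o snd)).
- move=> y; have [x px] := res_aug_surj P (p y).
  have /ker_p[z zE] : p (y - u x) = 0 by rewrite linearB /= uP px subrr.
  by exists (x, z); rewrite /= zE addrC subrK.
- move=> [x z] /= uxz.
  have /res_exact0[w wx] : res_aug P x = 0.
    rewrite -uP -[u x](addrK (i z)) uxz sub0r linearN.
    by rewrite (_ : p _ = 0) ?oppr0 //; apply/ker_p; eexists.
  rewrite -wx -gP /= -linearD (_ : v w + z = 0) ?linear0 //.
  by apply: inj_i; rewrite linearD /= vP /= wx.
by exists h => x; have := hP (0, x); rewrite /= !linear0 !add0r.
Qed.

(** The direct sum of copies of [g]. *)
Lemma dsum_map_exists (I : choiceType) (V W : lmodType R)
    (g : {linear V -> W}) :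
  exists F : {linear dsum I V -> dsum I W},
    forall i x, dsum_proj i (F x) = g (dsum_proj i x).
Proof.
have [F FP] := dsum_linear_ext (fun i => @dsum_inj R I W i \o g).
exists F => i; apply: dsum_ind => [|x y Fx Fy|j v].
- by rewrite !linear0.
- by rewrite !linearD /= Fx Fy.
- by rewrite FP /= !dsum_proj_inj; case: ifP => _; rewrite ?linear0.
Qed.

Lemma dsum_choose (I : choiceType) (V W : lmodType R)
    (g : {linear V -> W}) (x : dsum I W) :
    (forall i, exists v, g v = dsum_proj i x) ->
  exists y : dsum I V, forall i, g (dsum_proj i y) = dsum_proj i x.
Proof.
move=> /choice[v vP]; have [s us xs] := dsum_support x.
exists (\sum_(j <- s) dsum_inj j (v j)) => i.
rewrite [in RHS](dsum_sum_inj us xs) !linear_sum /=; apply: eq_bigr => j _.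
by rewrite !dsum_proj_inj; case: ifP => _; rewrite ?vP ?linear0.
Qed.

Lemma Ext_zero_dsum (I : choiceType) (V N : lmodType R) j :
  Ext_zero j V N -> Ext_zero j (dsum I V) N.
Proof.
move=> VN; have [P] := proj_resolution_exists V.
pose d l := sval (cid (dsum_map_exists I (res_diff P l))).
have dP l : forall i x, dsum_proj i (d l x) = res_diff P l (dsum_proj i x) :=
  svalP (cid (dsum_map_exists I (res_diff P l))).
have [a aP] := dsum_map_exists I (res_aug P).
have @Q : proj_resolution (dsum I V).
  apply: (@ProjResolution R _ (fun l => dsum I (res P l)) d a).
  - by move=> l; apply: projective_dsum (@res_projective _ _ P l).
  - move=> y; have [|x xP] := @dsum_choose I _ _ (res_aug P) y.
      by move=> l; apply: res_aug_surj.
    by exists x; apply: dsum_projP => l; rewrite aP.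
  - move=> x; split=> [ax|[y <-]]; last first.
      by apply: dsum_projP => l; rewrite aP dP res_augK linear0.
    have [|y yP] := @dsum_choose I _ _ (res_diff P 0) x.
      by move=> l; apply/res_exact0; rewrite -aP ax linear0.
    by exists y; apply: dsum_projP => l; rewrite dP.
  - move=> m x; split=> [ax|[y <-]]; last first.
      by apply: dsum_projP => l; rewrite !dP res_diffK linear0.
    have [|y yP] := @dsum_choose I _ _ (res_diff P m.+1) x.
      by move=> l; apply/res_exactS; rewrite -dP ax linear0.
    by exists y; apply: dsum_projP => l; rewrite dP.
have dE l m (v : res P l.+1) : d l (dsum_inj m v) = dsum_inj m (res_diff P l v).
  apply: dsum_projP => q; rewrite dP !dsum_proj_inj.
  by case: ifP => _; rewrite ?linear0.
apply: (@Ext_zero_of_res _ _ _ Q) => f cf.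
have cfi m : cocycle (f \o @dsum_inj R I _ m : {linear res P j -> N}).
  by move=> x; rewrite /= -dE; apply: cf.
have cb m := VN P _ (cfi m).
case: j => [|j] in VN f cf cfi cb *.
  apply: dsum_ind => [|x y /= fx fy|m v]; first by rewrite linear0.
    by rewrite linearD fx fy addr0.
  exact: cb.
have /choice[g gP] := cb; have [F FP] := dsum_linear_ext g.
exists F; apply: dsum_ind => [|x y fx fy|m v].
- by rewrite !linear0.
- by rewrite !linearD /= fx fy.
- by rewrite [LHS]gP -FP -dE.
Qed.

End ExtConsequences.

(** * Noetherian modules *)

Section Noetherian.
Variable R : pzRingType.
Implicit Types M N : lmodType R.

(** A nonempty family [F] of submodules of a Noetherian module has a maximal
    member above each of its members. *)
Lemma noetherian_max M (F : {pred M} -> Prop) (S0 : {pred M}) :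
    noetherian M -> (forall S, F S -> submod_closed S) -> F S0 ->
  exists T, [/\ F T, {subset S0 <= T}
    & forall T', F T' -> {subset T <= T'} -> {subset T' <= T}].
Proof.
move=> noethM clF FS0; apply: contrapT => no_max.
have [|i T [FT S0T]|s [_ sP]] := @dependent_choice_seq (fun=> {pred M})
  (fun _ T => F T /\ {subset S0 <= T})
  (fun _ T T' => [/\ F T, {subset T <= T'} & ~ {subset T' <= T}]) S0.
- by split.
- apply: contrapT => noT'; apply: no_max; exists T; split=> // T' FT' TT'.
  apply: contrapT => nT'T; apply: noT'; exists T' => //.
  by split=> // x /S0T/TT'.
have cls n : submod_closed (s n) by have [/clF] := sP n.
have incs n : {subset s n <= s n.+1} by have [] := sP n.
have [n /(_ n.+1 (leqnSn n)) eqS] := noethM s cls incs.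
by have [_ _ []] := sP n => x; rewrite eqS.
Qed.

Lemma noetherian_inj M N (i : {linear N -> M}) :
  (forall x, i x = 0 -> x = 0) -> noetherian M -> noetherian N.
Proof.
move=> inj_i noethM S clS incS.
pose T n : {pred M} := [pred y | `[< exists2 x, x \in S n & i x = y >]].
have TE n x : (i x \in T n) = (x \in S n).
  apply/asboolP/idP => [[z zS iz]|xS]; last by exists x.
  rewrite -(_ : z = x) //; apply/eqP; rewrite -subr_eq0; apply/eqP/inj_i.
  by rewrite linearB /= iz subrr.
have [n|n y /asboolP[x xS <-]|n nP] := noethM T.
- have [S0 SZ] := clS n; split=> [|a y z /asboolP[x xS <-] /asboolP[x' xS' <-]].
    by apply/asboolP; exists 0; rewrite ?linear0.
  by rewrite -linearP TE SZ.
- by rewrite TE incS.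
by exists n => m nm x; rewrite -!TE nP.
Qed.

Lemma noetherian_maximal_submod M (S : {pred M}) :
    noetherian M -> submod_closed S -> (exists x, x \notin S) ->
  exists2 T, maximal_submod T & {subset S <= T}.
Proof.
move=> noethM clS pS.
have [||T [[clT pT] ST maxT]] := @noetherian_max M
  (fun T => submod_closed T /\ exists x, x \notin T) S noethM.
- by move=> T [].
- by [].
by exists T => //; split=> // T' clT' TT' pT'; apply: maxT.
Qed.

End Noetherian.

(** * Right modules *)

Section RightModules.
Variable R : pzRingType.
Implicit Types (X Y : rmodType R) (a b : R).

(** The right action of [a] on [x]. *)
Definition ract X (x : X) a : X := (a : R^c) *: x.

Local Notation "x ** a" := (ract x a) (at level 40, left associativity).

Lemma ractM X (x : X) a b : x ** a ** b = x ** (a * b).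
Proof. exact: scalerA. Qed.

Lemma ract1 X (x : X) : x ** 1 = x.
Proof. exact: scale1r. Qed.

Lemma ract0 X (x : X) : x ** 0 = 0.
Proof. exact: scale0r. Qed.

Lemma ract0r X a : (0 : X) ** a = 0.
Proof. exact: scaler0. Qed.

Lemma ractD X (x : X) a b : x ** (a + b) = x ** a + x ** b.
Proof. exact: scalerDl. Qed.

Lemma ractB X (x : X) a b : x ** (a - b) = x ** a - x ** b.
Proof. exact: scalerBl. Qed.

Lemma ractDr X (x y : X) a : (x + y) ** a = x ** a + y ** a.
Proof. exact: scalerDr. Qed.

Lemma linear_ract X Y (g : {linear X -> Y}) x a : g (x ** a) = g x ** a.
Proof. exact: linearZ_LR. Qed.

End RightModules.
Notation "x ** a" := (ract x a) (at level 40, left associativity) : ring_scope.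

Section PrincipalRightModules.
Variables (R : pzRingType) (e : idem_elt R).

(** The element of [R] underlying an element of [eR]. *)
Definition eR_val (u : eR e) : R := submod_val u.

Lemma eR_val_inj : injective eR_val.
Proof. exact: val_inj. Qed.

Lemma eR_val_is_linear : linear (eR_val : eR e -> (R^c)^o).
Proof. by []. Qed.

Lemma eR_valZ (u : eR e) a : eR_val (u ** a) = eR_val u * a.
Proof. by []. Qed.

Lemma eR_valMl (u : eR e) : (e : R) * eR_val u = eR_val u.
Proof. by have /asboolP[a ua] := valP u; rewrite /eR_val ua mulrA idem_mul. Qed.

Lemma eR_elt_subproof a : ((e : R) * a : (R^c)^o) \in principal_pred e.
Proof. by apply/asboolP; exists a. Qed.

(** The element [e a] of [eR]. *)
Definition eR_elt a : eR e := Submod (eR_elt_subproof a).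

Lemma eR_eltE a : eR_val (eR_elt a) = (e : R) * a.
Proof. by []. Qed.

(** The generator [e] of [eR]. *)
Definition eR_gen : eR e := eR_elt 1.

Lemma eR_genE (u : eR e) : u = eR_gen ** eR_val u.
Proof. by apply: eR_val_inj; rewrite eR_valZ eR_eltE mulr1 eR_valMl. Qed.

Lemma eR_gen_e : eR_gen ** (e : R) = eR_gen.
Proof. by apply: eR_val_inj; rewrite eR_valZ eR_eltE mulr1 idem_mul. Qed.

Lemma eR_hom_exists (X : rmodType R) (x : X) :
  exists g : {linear eR e -> X}, forall u, g u = x ** eR_val u.
Proof.
have lin_g : linear (fun u : eR e => x ** eR_val u).
  by move=> a u v; rewrite /ract scalerA -scalerDl.
by exists (mk_linear lin_g).
Qed.

Lemma eR_projective : projective (eR e).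
Proof.
move=> M N g f surj_g; have [x gx] := surj_g (f eR_gen).
have [h hP] := eR_hom_exists x.
by exists h => u; rewrite hP linear_ract gx -linear_ract -eR_genE.
Qed.

End PrincipalRightModules.

(** * The Jacobson radical *)

Section Radical.
Variables (R : pzRingType).
Hypothesis noethR : noetherian (R^c)^o.

Lemma jacobson_rinv (j : R) : j \in jacobson R -> exists u, (1 - j) * u = 1.
Proof.
move=> jJ; apply: contrapT => no_inv.
have [||T maxT sT] :=
  @noetherian_maximal_submod _ _ (principal_pred (1 - j)) noethR.
- exact: principal_closed.
- exists (1 : R); apply/asboolP => -[u u1].
  by apply: no_inv; exists u.
have [clT [x xT] _] := maxT.
have jT : (j : (R^c)^o) \in T by apply: (jacobsonP j jJ).
have T1 : (1 : R) \in T.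
  rewrite -(subrK j 1); apply: (@rideal_closedD R T) jT => //; apply: sT.
  by apply/asboolP; exists 1; rewrite mulr1.
by have := @rideal_closedMr R T 1 x clT T1; rewrite mul1r (negPf xT).
Qed.

(** The right inverse [u] of [1 - j] is [1 + j u], so it is right invertible
    too. *)
Lemma jacobson_inv (j : R) :
  j \in jacobson R -> exists u, (1 - j) * u = 1 /\ u * (1 - j) = 1.
Proof.
move=> jJ; have [u u1] := jacobson_rinv jJ; exists u; split=> //.
have uE : u = 1 - - (j * u) by rewrite opprK -[X in X + _]u1 mulrBl mul1r subrK.
have [v] : exists v, (1 - - (j * u)) * v = 1.
  by apply: jacobson_rinv; rewrite rpredN jacobsonMr.
rewrite -uE => v1; suff -> : 1 - j = v by [].
by rewrite -[LHS]mulr1 -[X in _ * X]v1 mulrA u1 mul1r.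
Qed.

Lemma jacobson_idem (e : idem_elt R) : (e : R) \in jacobson R -> (e : R) = 0.
Proof.
move=> /jacobson_inv[u [_ u1]].
by rewrite -[LHS]mul1r -u1 -mulrA mulrBl mul1r idem_mul subrr mulr0.
Qed.

End Radical.

Section RadicalQuotient.
Variables (k : fieldType) (A : algType k).

Lemma radquot_proj0 (a : A) : (radquot_proj a == 0) = (a \in jacobson A).
Proof. by rewrite -(rmorph0 radquot_proj) radquot_projP subr0. Qed.

Variable e : idem_elt A.
Hypothesis noethA : noetherian (A^c)^o.
Hypothesis e_primitive : primitive_idem e.
Hypothesis A_semiperfect : semiperfect_algebra A.

(** A primitive idempotent stays primitive modulo the radical: an idempotent
    lift [g] of [x] is first conjugated so as to vanish on [1 - e], and then
    multiplied by [e] on the left. *)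
Lemma primitive_radquot (x : radquot A) :
    x * x = x -> radquot_proj (idem_val e) * x = x ->
    x * radquot_proj (idem_val e) = x ->
  x = 0 \/ x = radquot_proj (idem_val e).
Proof.
move=> xx ex xe; have [_ /(_ x xx)[g gg gx]] := A_semiperfect.
have jJ : g * (1 - idem_val e) \in jacobson A.
  by rewrite -radquot_proj0 rmorphM rmorphB rmorph1 /= gx mulrBr mulr1 xe subrr.
have [u [tu ut]] := jacobson_inv noethA jJ; set t := 1 - _ in tu ut.
have gt : g * t = g * idem_val e.
  by rewrite /t mulrBr mulr1 mulrA gg mulrBr mulr1 opprB addrC subrK.
pose h := u * g * idem_val e.
have hh : h * h = h.
  have hE : h = u * g * t by rewrite /h -!mulrA gt.
  rewrite [X in X * _]hE /h !mulrA -(mulrA (u * g) t u) tu mulr1.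
  by rewrite -(mulrA u g g) gg.
have he : h * idem_val e = h by rewrite /h -mulrA idem_mul.
pose f := idem_val e * h.
have ff : f * f = f by rewrite /f -mulrA (mulrA h) he hh.
have ef : idem_val e * f = f by rewrite /f mulrA idem_mul.
have fe : f * idem_val e = f by rewrite /f -mulrA he.
have fx : radquot_proj f = x.
  have pt : radquot_proj t = 1.
    rewrite /t rmorphB rmorph1 /= (_ : radquot_proj _ = 0) ?subr0 //.
    by apply/eqP; rewrite radquot_proj0.
  have pu : radquot_proj u = 1.
    by rewrite -[LHS]mulr1 -pt -rmorphM ut rmorph1.
  by rewrite /f /h !rmorphM /= pu mul1r gx xe ex.
have gg' : (idem_val e - f) * (idem_val e - f) = idem_val e - f.
  by rewrite mulrBr !mulrBl idem_mul ef fe ff subrr subr0.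
have [_ /(_ (IdemElt ff) (IdemElt gg')) /=] := e_primitive.
case; rewrite ?mulrBr ?mulrBl ?ef ?fe ?ff ?subrr //.
- by rewrite addrC subrK.
- by move=> f0; left; rewrite -fx f0 rmorph0.
- by move=> /eqP; rewrite subr_eq0 => /eqP ->; right.
Qed.

Hypothesis A_basic : basic_algebra A.

(** The image of [e] in the product of division rings [A / rad A] is the unit of
    one of the factors [D i0]. *)
Lemma primitive_basic :
  (forall a : A, idem_val e * a * (1 - idem_val e) \in jacobson A) /\
  (forall a : A, idem_val e * a \in jacobson A \/
    exists b, idem_val e * a * b - idem_val e \in jacobson A).
Proof.
have [n [D [p [divD bijp]]]] := A_basic.
have injp x : (forall i, p i x = 0) -> x = 0.
  move=> px; have [y [_ uy]] := bijp (fun=> 0).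
  by rewrite -(uy x px); apply: uy => i; rewrite rmorph0.
have eJ : idem_val e \notin jacobson A.
  by apply/negP => /(jacobson_idem noethA) e0; have [/eqP] := e_primitive.
pose ebar := radquot_proj (idem_val e).
have ee : ebar * ebar = ebar by rewrite -rmorphM idem_mul.
have p01 i : p i ebar = 0 \/ p i ebar = 1.
  have [->|nz] := eqVneq (p i ebar) 0; [by left | right].
  have [y [xy yx]] := divD i _ nz.
  by rewrite -[LHS]mul1r -yx -mulrA -rmorphM ee yx.
have [i0 pi0] : exists i0, p i0 ebar = 1.
  apply: contrapT => no1; move: eJ; rewrite -radquot_proj0 => /eqP; apply.
  by apply: injp => i; have [//|p1] := p01 i; case: no1; exists i.
have pi i : i != i0 -> p i ebar = 0.
  move=> ii0; have [x [px _]] := bijp (fun i => if i == i0 then 1 else 0).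
  have eqp y z : (forall i, p i y = p i z) -> y = z.
    move=> yz; apply/eqP; rewrite -subr_eq0; apply/eqP/injp => l.
    by rewrite rmorphB /= yz subrr.
  have [|||x0|xe] := @primitive_radquot x.
  - by apply: eqp => l; rewrite rmorphM /= px; case: ifP; rewrite ?mulr1 ?mulr0.
  - apply: eqp => l; rewrite rmorphM /= px.
    by case: eqP => [->|_]; rewrite ?pi0 ?mulr1 ?mulr0.
  - apply: eqp => l; rewrite rmorphM /= px.
    by case: eqP => [->|_]; rewrite ?pi0 ?mulr1 ?mul0r.
  - have := px i0; rewrite x0 rmorph0 eqxx => /esym/eqP.
    by rewrite oner_eq0.
  - by rewrite /ebar -xe px (negPf ii0).
have memJ a : (forall i, p i (radquot_proj a) = 0) -> a \in jacobson A.
  by move=> pa; rewrite -radquot_proj0; apply/eqP/injp.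
split=> a.
  apply: memJ => i; rewrite !rmorphM rmorphB !rmorph1 rmorphB rmorph1 /=.
  have [->|/pi->] := eqVneq i i0; last by rewrite !mul0r.
  by rewrite pi0 subrr mulr0.
have [a0|nz] := eqVneq (p i0 (radquot_proj a)) 0.
  left; apply: memJ => i; rewrite !rmorphM /=.
  by have [->|/pi->] := eqVneq i i0; rewrite ?a0 ?mulr0 ?mul0r.
right.
have inv i : exists y,
    p i (radquot_proj a) != 0 -> p i (radquot_proj a) * y = 1.
  have [->|/divD[y [ay _]]] := eqVneq (p i (radquot_proj a)) 0.
    by exists 0.
  by exists y.
have [x [px _]] := bijp (fun i => sval (cid (inv i))).
exists (radquot_lift x); apply: memJ => i.
rewrite rmorphB !rmorphM rmorphB !rmorphM /= radquot_liftK px.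
have [->|ii0] := eqVneq i i0; last by rewrite (pi i) // !mul0r subrr.
by rewrite pi0 mul1r (svalP (cid (inv i0))) // subrr.
Qed.

End RadicalQuotient.

(** * Modules killed by the complementary idempotent *)

Section TopModules.
Variables (R : pzRingType) (e : idem_elt R).

Local Notation J := (jacobson R).
Local Notation S := (top_eR e).

Hypothesis eafJ : forall a, (e : R) * a * (1 - (e : R)) \in J.
Hypothesis eaJ : forall a,
  (e : R) * a \in J \/ exists b, (e : R) * a * b - (e : R) \in J.

(** The right module [X] is annihilated by [1 - e]. *)
Definition complement_killed (X : rmodType R) :=
  forall x : X, x ** (1 - (e : R)) = 0.

(** The right module [X] is annihilated by the radical. *)
Definition radical_killed (X : rmodType R) :=
  forall (x : X) j, j \in J -> x ** j = 0.

Lemma complement_killedE (X : rmodType R) (x : X) :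
  complement_killed X -> x ** (e : R) = x.
Proof.
by move=> kX; rewrite -[RHS]ract1 -(subrK (e : R) 1) ractD kX add0r.
Qed.

(** The projection from [eR] onto its top. *)
Definition top_proj : {linear eR e -> S} := quotmod_proj (erad_pred e).

Lemma top_proj_surj (s : S) : exists u, top_proj u = s.
Proof. by eexists; apply: quotmod_projK. Qed.

Lemma top_proj0 (u : eR e) : top_proj u = 0 <-> eR_val u \in J.
Proof.
have -> : top_proj u = 0 <-> u \in erad_pred e.
  have -> : (u \in erad_pred e) = (top_proj u == top_proj 0).
    by rewrite quotmod_projP subr0.
  by split=> [/eqP|/eqP]; rewrite linear0 => // /eqP.
split=> [/asboolP[r rJ]|uJ]; first by rewrite /eR_val => ->; apply: jacobsonMl.
by apply/asboolP; exists (eR_val u); rewrite // eR_valMl.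
Qed.

Lemma top_complement_killed : complement_killed S.
Proof.
move=> s; have [u <-] := top_proj_surj s.
by rewrite -linear_ract; apply/top_proj0; rewrite eR_valZ -eR_valMl.
Qed.

Lemma top_radical_killed : radical_killed S.
Proof.
move=> s j jJ; have [u <-] := top_proj_surj s.
by rewrite -linear_ract; apply/top_proj0; rewrite eR_valZ jacobsonMl.
Qed.

Section Semisimple.
Variable X : rmodType R.
Hypotheses (fX : complement_killed X) (JX : radical_killed X).

(** On a module killed by [1 - e] and by the radical, the action of [R] is that
    of the division ring [eRe / e rad R e]. *)
Lemma ract_invertible (x : X) a : x ** a != 0 -> exists b, x ** a ** b = x.
Proof.
have xe := complement_killedE x fX => xa.
have xea b : x ** ((e : R) * b) = x ** b by rewrite -ractM xe.
case: (eaJ a) => [eaJ'|[b abJ]].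
  by case/eqP: xa; rewrite -xea JX.
exists b; rewrite ractM -xea mulrA; apply/eqP.
by rewrite -subr_eq0 -{2}xe -ractB JX.
Qed.

Lemma top_embedding (x : X) : x != 0 ->
  exists i : {linear S -> X},
    (forall s, i s = 0 -> s = 0) /\ forall u, i (top_proj u) = x ** eR_val u.
Proof.
move=> x0; have [g gE] := eR_hom_exists e x.
have [|i iE] := factor_surj (t := g) top_proj_surj.
  by move=> u /top_proj0 uJ; rewrite gE JX.
exists i; split=> [s|u]; last by rewrite iE gE.
have [u <-] := top_proj_surj s; rewrite iE gE => xu; apply/top_proj0.
rewrite -eR_valMl; have [//|[b]] := eaJ (eR_val u).
rewrite eR_valMl => ubJ; have := JX x ubJ.
rewrite ractB -ractM xu ract0r sub0r complement_killedE // => /eqP.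
by rewrite oppr_eq0 (negPf x0).
Qed.

(** Zorn's lemma gives a submodule [U] maximal among those that meet [T]
    trivially; it is a complement of [T]. *)
Lemma semisimple_projector (T : {pred X}) : submod_closed T ->
  exists q : {linear X -> X},
    (forall x, q x \in T) /\ (forall x, x \in T -> q x = x).
Proof.
move=> clT.
have [T0 TZ] := clT.
pose disj (U : {pred X}) :=
  submod_closed U /\ forall x, x \in U -> x \in T -> x = 0.
pose le (U V : {U | disj U}) := `[< {subset sval U <= sval V} >].
have disj0 : disj (pred1 0).
  split; last by move=> x; rewrite inE => /eqP.
  by split=> [|a u v]; rewrite !inE // => /eqP-> /eqP->; rewrite scaler0 addr0.
have [||F totF|[U [clU dU]] maxU] :=
    @classical_sets.ZL_preorder _ (exist _ _ disj0) le.
- by move=> U; apply/asboolP.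
- by move=> U V W /asboolP UV /asboolP VW; apply/asboolP => x /UV/VW.
- have [[U0 FU0]|nF] := pselect (exists U, F U); last first.
    by exists (exist _ _ disj0) => U FU; case: nF; exists U.
  pose V : {pred X} := [pred x | `[< exists2 U, F U & x \in sval U >]].
  have dV : disj V.
    split=> [|x /asboolP[U _ xU]]; last by apply: (svalP U).2.
    split=> [|a u v /asboolP[U FU uU] /asboolP[W FW vW]].
      by apply/asboolP; exists U0 => //; have [[]] := svalP U0.
    apply/asboolP; have [/asboolP UW|/asboolP WU] := totF _ _ FU FW.
      by exists W => //; have [[_ WZ] _] := svalP W; apply: WZ; first exact: UW.
    by exists U => //; have [[_ UZ] _] := svalP U; apply: UZ; last exact: WU.
  exists (exist _ _ dV) => U FU; apply/asboolP => x xU; apply/asboolP.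
  by exists U.
have [U0 UZ] := clU.
have UT x : exists2 t, t \in T & x - t \in U.
  have [xU|xU] := boolP (x \in U); first by exists 0; rewrite ?subr0.
  pose V : {pred X} := [pred y | `[< exists a, y - x ** a \in U >]].
  have clV : submod_closed V.
    split=> [|a y z /asboolP[b yb] /asboolP[c zc]]; apply/asboolP.
      by exists 0; rewrite ract0 subr0.
    exists (b * (a : R) + c); rewrite ractD -ractM opprD addrACA -scalerBr.
    exact: UZ.
  have UV : {subset U <= V}.
    by move=> y yU; apply/asboolP; exists 0; rewrite ract0 subr0.
  have xV : x \in V by apply/asboolP; exists 1; rewrite ract1 subrr.
  (* Otherwise [U + x R] still meets [T] trivially: if [y] is in [T] and
     [y - x a] in [U], then either [x a = 0], or [x a b = x] for some [b] and
     [x] is in [y b + U]. *)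
  apply: contrapT => nx.
  have dV : disj V.
    split=> // y /asboolP[a yaU] yT.
    have [xa|xa] := eqVneq (x ** a) 0.
      by apply: (dU _) => //; rewrite xa subr0 in yaU.
    have [b xab] := ract_invertible xa; case: nx; exists (y ** b).
      by have := TZ (b : R^c) y 0 yT T0; rewrite addr0.
    have -> : x - y ** b = (- b : R^c) *: (y - x ** a) + 0.
      rewrite addr0 scaleNr scalerBr opprB; congr (_ - _).
      exact/esym.
    exact: UZ.
  have leUV : le (exist _ U (conj clU dU)) (exist _ V dV) by apply/asboolP.
  have /asboolP VU := maxU _ leUV.
  by move/negP: xU; apply; apply: VU.
have [|||q qP] := @linear_of_graph _ X X (fun x t => t \in T /\ x - t \in U).
- by move=> x; have [t] := UT x; exists t.
- move=> t [tT tU]; apply: (dU _) => //.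
  by have := UZ (-1) _ _ tU U0; rewrite addr0 sub0r scaleN1r opprK.
- move=> a x y x' y' [yT xyU] [yT' xyU']; split; first exact: TZ.
  by rewrite opprD addrACA -scalerBr; apply: UZ.
exists q; split=> x; first by have [] := qP x.
have [qT qU] := qP x => xT; apply/eqP; rewrite eq_sym -subr_eq0; apply/eqP.
apply: (dU _) => //; have := TZ (-1) _ _ qT xT.
by rewrite scaleN1r addrC.
Qed.

Lemma top_retract (x : X) : x != 0 ->
  exists (i : {linear S -> X}) (r : {linear X -> S}), forall s, r (i s) = s.
Proof.
move=> x0; have [i [inj_i _]] := top_embedding x0.
have [q [qi iq]] := semisimple_projector (image_closed i).
have [y|r rE] := lift_inj inj_i (g := q).
  by have /asboolP := qi y.
exists i, r => s; apply/eqP; rewrite -subr_eq0; apply/eqP/inj_i.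
by rewrite linearB /= rE iq ?subrr //; apply/asboolP; exists s.
Qed.

End Semisimple.

Lemma surjection_section (X Y : rmodType R) (g : {linear Y -> X}) :
    complement_killed Y -> radical_killed Y -> (forall x, exists y, g y = x) ->
  exists s : {linear X -> Y}, forall x, g (s x) = x.
Proof.
move=> fY JY surj_g.
have [q [qg gq]] := semisimple_projector fY JY (kernel_closed g).
have [y gy|s sE] := factor_surj (s := g) (t := idfun \- q) surj_g.
  by rewrite /= gq ?subrr //; apply/asboolP.
exists s => x; have [y <-] := surj_g x.
by have /asboolP gqy := qg y; rewrite sE linearB /= gqy subr0.
Qed.

(** The sum of all maps [S -> X] given by the elements of [X] is surjective, and
    it splits. *)
Lemma Ext_zero_semisimple (X N : rmodType R) j :
    complement_killed X -> radical_killed X ->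
  Ext_zero j S N -> Ext_zero j X N.
Proof.
move=> fX JX SN.
have emb (x : X) : exists i : {linear S -> X}, exists s, x != 0 -> i s = x.
  have [->|x0] := eqVneq x 0; first by exists \0, 0 => /eqP.
  have [i [_ iE]] := top_embedding fX JX x0.
  exists i, (top_proj (eR_gen e)) => _.
  by rewrite iE eR_eltE mulr1 complement_killedE.
have [i iP] := choice emb.
have [g gE] := dsum_linear_ext i.
have [||x|s sE] := @surjection_section X (dsum X S) g.
- move=> y; apply: dsum_projP => x.
  by rewrite linear_ract top_complement_killed linear0.
- move=> y j' jJ; apply: dsum_projP => x.
  by rewrite linear_ract top_radical_killed // linear0.
- have [->|x0] := eqVneq x 0; first by exists 0; rewrite linear0.
  by have [s /(_ x0) sx] := iP x; exists (dsum_inj x s); rewrite gE.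
exact: (Ext_zero_retraction sE (Ext_zero_dsum SN)).
Qed.

Hypothesis noethR : noetherian (R^c)^o.
Hypothesis ExtS : Ext_zero 1 S S.

(** If [X] is killed by [1 - e] but not by the radical, then some simple
    quotient [Y] of [K = e rad R] is killed by [1 - e].  It is then isomorphic
    to [S], giving a nonzero map from [K] to [S].  That map extends to [eR],
    but every map from [eR] to [S] vanishes on [K]. *)
Lemma complement_killed_radical (X : rmodType R) :
  complement_killed X -> radical_killed X.
Proof.
move=> fX x j jJ.
rewrite -(complement_killedE x fX) ractM; apply: contrapT => /eqP xej.
have [K [k [inj_k im_k]]] := kernel_exists top_proj.
have [g gE] := eR_hom_exists e x.
have noethK : noetherian K.
  apply: (@noetherian_inj _ _ _
    (mk_linear (@eR_val_is_linear R e) \o k)) noethR.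
  by move=> w /= kw; apply: inj_k; apply: eR_val_inj.
have [w0 kw0] : exists w, k w = eR_elt e j.
  by apply/im_k/top_proj0; rewrite eR_eltE jacobsonMl.
have [||T [clT [w wT] maxT] gT] :=
    @noetherian_maximal_submod _ K [pred w | `[< (g \o k) w = 0 >]] noethK.
- exact: kernel_closed.
- exists w0; apply/asboolP; rewrite /= kw0 gE => /eqP.
  by rewrite eR_eltE (negPf xej).
have [T0 TZ] := clT.
have [Y [p [surj_p ker_p]]] := quotient_exists clT.
have Y_simple (y y' : Y) : y != 0 -> exists a, y ** a = y'.
  have [v <-] := surj_p y => pv; have [v' <-] := surj_p y'.
  pose T1 : {pred K} := [pred z | `[< exists a, z - v ** a \in T >]].
  suff /asboolP[a vaT] : v' \in T1.
    exists a; apply/eqP; rewrite -linear_ract eq_sym -subr_eq0 -linearB.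
    exact/eqP/ker_p.
  apply: contrapT => /negP v'T1.
  have clT1 : submod_closed T1.
    split=> [|a u z /asboolP[b ub] /asboolP[c zc]]; apply/asboolP.
      by exists 0; rewrite ract0 subr0.
    exists (b * (a : R) + c); rewrite ractD -ractM opprD addrACA -scalerBr.
    exact: TZ.
  have TT1 : {subset T <= T1}.
    by move=> u uT; apply/asboolP; exists 0; rewrite ract0 subr0.
  have vT : v \in T.
    apply: (maxT T1) => //; first by exists v'.
    by apply/asboolP; exists 1; rewrite ract1 subrr.
  by case/eqP: pv; apply/ker_p.
have fY : complement_killed Y.
  move=> y; have [v <-] := surj_p y.
  rewrite -linear_ract; apply/ker_p/gT/asboolP.
  by rewrite linear_ract; apply: fX.
have JY : radical_killed Y.
  move=> y i iJ; apply: contrapT => /eqP yi.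
  have [b yib] := Y_simple _ y yi.
  have [|c [ibc _]] := @jacobson_inv R noethR (i * b); first exact: jacobsonMr.
  have y0 : y ** (1 - i * b) = 0 by rewrite ractB ract1 -ractM yib subrr.
  case/eqP: yi; rewrite (_ : y = 0) ?ract0r //.
  by rewrite -[y]ract1 -ibc -ractM y0 ract0r.
have pw : p w != 0 by apply/eqP => /ker_p; rewrite (negPf wT).
have [i [inj_i iE]] := top_embedding fY JY pw.
have [|h hE] := lift_inj inj_i (g := idfun : {linear Y -> Y}).
  move=> y; have [|a ay] := Y_simple (i (top_proj (eR_gen e))) y.
    by rewrite iE eR_eltE mulr1 complement_killedE.
  by exists (top_proj (eR_gen e) ** a); rewrite linear_ract.
have ex : short_exact k top_proj by split=> //; apply: top_proj_surj.
have [G GE] := Ext_zero1_extend (h \o p) ex ExtS.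
case/eqP: pw; rewrite -[LHS]/(idfun (p w)) -hE -[h _]GE.
have /top_proj0 kJ : top_proj (k w) = 0 by apply/im_k; exists w.
by rewrite (eR_genE (k w)) linear_ract top_radical_killed // linear0.
Qed.

End TopModules.

(** * Induction from the corner ring *)

Section Induction.
Variables (R : pzRingType) (f : idem_elt R).

Section Module.
Variable M : rmodType (corner f).

(** The relations [(m c + m') (x) u = m (x) c u + m' (x) u]. *)
Definition induced_rel_pred : {pred dsum M (eR f)} :=
  [pred z | `[< forall T : {pred dsum M (eR f)}, submod_closed T ->
    (forall (m m' : M) (c : corner f) (u : eR f),
       dsum_inj (m ** c + m') u - (dsum_inj m (corner_lmul c u) + dsum_inj m' u)
         \in T) ->
    z \in T >]].

Lemma induced_rel_closed : submod_closed induced_rel_pred.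
Proof.
split=> [|a x y /asboolP xT /asboolP yT]; apply/asboolP => T clT relT.
  by case: clT.
by case: (clT) => _; apply; [apply: xT | apply: yT].
Qed.

(** The right module [M (x) fR] over [R], for a right module [M] over [fRf]:
    the direct sum of the copies [m (x) fR] of [fR], modulo linearity in [m]. *)
Definition induced : rmodType R := quotmod (mk_submod induced_rel_closed).

Definition induced_proj : {linear dsum M (eR f) -> induced} :=
  quotmod_proj (mk_submod induced_rel_closed).

Lemma induced_proj0 z : induced_proj z = 0 <-> z \in induced_rel_pred.
Proof.
have -> : (z \in induced_rel_pred) = (induced_proj z == induced_proj 0).
  by rewrite quotmod_projP subr0.
by split=> [/eqP|/eqP]; rewrite linear0 => // /eqP.
Qed.

(** The element [m (x) u], as a linear function of [u]. *)
Definition tens (m : M) : {linear eR f -> induced} :=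
  induced_proj \o dsum_inj m.

Lemma tens_linear m m' c u :
  tens (m ** c + m') u = tens m (corner_lmul c u) + tens m' u.
Proof.
apply/eqP; rewrite -subr_eq0 /= -!linearD -linearB.
by apply/eqP/induced_proj0/asboolP => T _; apply.
Qed.

Lemma induced_ind (P : induced -> Prop) :
    P 0 -> (forall x y, P x -> P y -> P (x + y)) ->
    (forall m u, P (tens m u)) ->
  forall x, P x.
Proof.
move=> P0 PD Pt x; rewrite -[x]quotmod_projK.
move: (repr _) => z; rewrite -/(induced_proj z); move: z.
apply: dsum_ind => [|y z Py Pz|m u]; first by rewrite linear0.
  by rewrite linearD; apply: PD.
exact: Pt.
Qed.

(** Half of the adjunction between induction and [Hom (fR, -)]. *)
Lemma induced_ext (X : rmodType R) (u : {linear M -> corner_hom f X}) :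
  exists F : {linear induced -> X},
    forall m w, F (tens m w) = corner_hom_fun (u m) w.
Proof.
have [G GE] := dsum_linear_ext (fun m => corner_hom_fun (u m)).
have [y|z|F FE] := @factor_surj _ (dsum M (eR f)) induced X induced_proj G.
- by eexists; apply: quotmod_projK.
- move=> /induced_proj0/asboolP/(_ _ (kernel_closed G)) Gz.
  apply/asboolP/Gz => m m' c w; apply/asboolP.
  rewrite linearB linearD !GE linearD /= -[m ** c]/((c : (corner f)^c) *: m).
  by rewrite linearZ /= subrr.
by exists F => m w; rewrite FE GE.
Qed.

Lemma corner_of_subproof (w : eR f) : eR_val w * (f : R) \in corner_pred f.
Proof. by apply/asboolP; exists (eR_val w); rewrite eR_valMl. Qed.

(** The element [w f] of [fRf], for [w] in [fR]. *)
Definition corner_of (w : eR f) : corner f := Corner (corner_of_subproof w).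

(** [m |-> m (x) f] is injective: [m (x) u |-> m (u f)] is a left inverse, which
    is well defined as an additive map. *)
Lemma tens_gen_inj m : tens m (eR_gen f) = 0 -> m = 0.
Proof.
have [m' v w|F [FD Fi]] :=
  @dsum_additive_ext _ M (eR f) M (fun m w => m ** corner_of w).
  by rewrite -ractD; congr (_ ** _); apply: val_inj; apply: mulrDl.
have F0 : F 0 = 0 by apply: (addrI (F 0)); rewrite -FD !addr0.
have FN x : F (- x) = - F x by apply: (addrI (F x)); rewrite -FD !subrr.
(* The kernel of [F] need not be a submodule over [R], but its largest submodule
   contains all relations. *)
pose T : {pred dsum M (eR f)} := [pred z | `[< forall a, F (z ** a) = 0 >]].
have clT : submod_closed T.
  split=> [|a x y /asboolP xT /asboolP yT]; apply/asboolP => b.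
    by rewrite ract0r F0.
  by rewrite -[a *: x]/(x ** a) ractDr ractM FD xT yT addr0.
have FZ m' w a : F (dsum_inj m' w ** a) = m' ** corner_of (w ** a).
  by rewrite -linear_ract Fi.
move=> /induced_proj0/asboolP/(_ T clT) mT.
have {mT} /asboolP/(_ 1) : dsum_inj m (eR_gen f) \in T.
  apply: mT => m1 m2 c u; apply/asboolP => a.
  have ractN (x : dsum M (eR f)) : (- x) ** a = - (x ** a) by apply: scalerN.
  rewrite ractDr ractN ractDr FD FN FD !FZ ractDr ractM.
  rewrite (_ : c * corner_of (u ** a) = corner_of (corner_lmul c u ** a)).
    exact: subrr.
  by apply: val_inj; rewrite /= /eR_val /= !mulrA.
rewrite ract1 Fi (_ : corner_of _ = 1) ?ract1 //.
by apply: val_inj; rewrite /= /eR_val /= mulr1 idem_mul.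
Qed.

Lemma corner_lmul1 u : corner_lmul (1 : corner f) u = u.
Proof. by apply: eR_val_inj; apply: eR_valMl. Qed.

Lemma tens0l u : tens 0 u = 0.
Proof.
have := tens_linear 0 0 1 u; rewrite ract0r add0r corner_lmul1.
by rewrite -[LHS]addr0 => /addrI.
Qed.

Lemma tensDl m m' u : tens (m + m') u = tens m u + tens m' u.
Proof. by have := tens_linear m m' 1 u; rewrite ract1 corner_lmul1. Qed.

Lemma tensZl m c u : tens (m ** c) u = tens m (corner_lmul c u).
Proof. by have := tens_linear m 0 c u; rewrite addr0 tens0l addr0. Qed.

(** Multiplying [M (x) fR] by [f] recovers [M (x) fRf = M]. *)
Lemma induced_ract_idem (z : induced) :
  exists m, z ** (f : R) = tens m (eR_gen f).
Proof.
move: z; apply: induced_ind => [|x y [m xm] [m' ym']|m u].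
- by exists 0; rewrite ract0r tens0l.
- by exists (m + m'); rewrite ractDr xm ym' tensDl.
- exists (m ** corner_of u); rewrite tensZl -linear_ract.
  congr (tens m _); apply: eR_val_inj.
  by rewrite eR_valZ /eR_val /= mulr1 -mulrA idem_mul.
Qed.

Lemma induced_hom0 (X : rmodType R) (g : {linear induced -> X}) :
  (forall x : X, x ** (f : R) = 0) -> forall z, g z = 0.
Proof.
move=> fX; apply: induced_ind => [|x y gx gy|m u]; first exact: linear0.
  by rewrite linearD gx gy addr0.
rewrite (eR_genE u) 2!linear_ract.
by rewrite -(eR_gen_e f) 2!linear_ract fX ract0r.
Qed.

End Module.

Lemma corner_hom_comp_linear (X Y : rmodType R) (g : {linear X -> Y}) :
  linear (fun phi : corner_hom f X =>
    (g \o corner_hom_fun phi : {linear eR f -> Y}) : corner_hom f Y).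
Proof. by move=> a phi psi; apply: corner_homP => x; rewrite /= linearD. Qed.

(** By adjunction, as [Hom (fR, -)] preserves surjections. *)
Lemma induced_projective (M : rmodType (corner f)) :
  projective M -> projective (induced M).
Proof.
move=> projM X Y g h surj_g.
pose hM (m : M) : corner_hom f Y := h \o tens m.
have lin_hM : linear hM.
  move=> c m m'; apply: corner_homP => w.
  apply: etrans (linearD h _ _).
  exact: (congr1 h (tens_linear m m' (c : corner f) w)).
have [phi|l lP] := projM _ _
  (mk_linear (corner_hom_comp_linear g)) (mk_linear lin_hM).
  have [psi psiP] := @eR_projective R f X Y g (corner_hom_fun phi) surj_g.
  by exists psi; apply: corner_homP => x; apply: psiP.
have [H HE] := induced_ext l; exists H.
apply: induced_ind => [|x y Hx Hy|m w]; first by rewrite !linear0.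
  by rewrite !linearD Hx Hy.
by rewrite HE; have := congr1 (fun phi => corner_hom_fun phi w) (lP m).
Qed.

Lemma induced_map_exists (M M' : rmodType (corner f)) (d : {linear M -> M'}) :
  exists F : {linear induced M -> induced M'},
    forall m w, F (tens m w) = tens (d m) w.
Proof.
have lin_u : linear (fun m : M => tens (d m) : corner_hom f (induced M')).
  move=> c m m'; apply: corner_homP => w.
  by rewrite linearP; apply: tens_linear.
have [F FE] := induced_ext (mk_linear lin_u).
by exists F.
Qed.

End Induction.

(** * Lowering the top degree of the self-extensions of [S] *)

Section TopExt.
Variables (R : pzRingType) (e : idem_elt R).

Local Notation J := (jacobson R).
Local Notation S := (top_eR e).

Hypothesis eaJ : forall a,
  (e : R) * a \in J \/ exists b, (e : R) * a * b - (e : R) \in J.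
Hypothesis eafJ : forall a, (e : R) * a * (1 - (e : R)) \in J.
Hypothesis killed_top :
  forall X : rmodType R, complement_killed e X -> radical_killed X.

(** A bounded complex of projective modules with no maps to [S] in positive
    degrees, whose homology is [S] in degree zero and is killed by [1 - e] in
    positive degrees. *)
Variables (C : nat -> rmodType R) (d : forall i, {linear C i.+1 -> C i}).
Variable p : {linear C 0 -> S}.
Hypothesis dd : forall i x, d i (d i.+1 x) = 0.
Hypothesis d_exact :
  forall i x, d i x = 0 -> exists y, d i.+1 y = x ** (1 - (e : R)).
Hypothesis p_surj : forall s, exists x, p x = s.
Hypothesis p_exact : forall x, p x = 0 <-> exists y, d 0 y = x.
Hypothesis C_projective : forall i, projective (C i).
Hypothesis C_hom0 : forall i, Ext_zero 0 (C i.+1) S.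
Variable N : nat.
Hypothesis C_bounded : forall i, (N < i)%N -> forall x : C i, x = 0.

(** [b] identifies [B] with the module of boundaries in [C i]. *)
Definition boundaries i (B : rmodType R) (b : {linear B -> C i}) :=
  (forall x, b x = 0 -> x = 0) /\
  (forall y, (exists x, b x = y) <-> exists w, d i w = y).

Lemma boundaries_exist i :
  exists (B : rmodType R) (b : {linear B -> C i}), boundaries b.
Proof.
have [B [b [inj_b im_b]]] := submodule_exists (image_closed (d i)).
exists B, b; split=> // y.
by split=> [/im_b/asboolP //|dy]; apply/im_b/asboolP.
Qed.

(** The cycles [Z] and the homology [H] in degree [i.+1]. *)
Lemma cycles_homology i (B B' : rmodType R) (b : {linear B -> C i})
    (b' : {linear B' -> C i.+1}) :
    boundaries b -> boundaries b' ->
  exists (Z H : rmodType R) (z : {linear Z -> C i.+1})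
         (c : {linear C i.+1 -> B}) (i' : {linear B' -> Z})
         (h : {linear Z -> H}),
    [/\ short_exact z c, short_exact i' h & complement_killed e H].
Proof.
move=> [inj_b im_b] [inj_b' im_b'].
have [Z [z [inj_z ker_d]]] := kernel_exists (d i).
have [x|c cE] := lift_inj inj_b (g := d i); first by apply/im_b; exists x.
have [x|i' i'E] := lift_inj inj_z (g := b').
  apply/ker_d; have [w <-] : exists w, d i.+1 w = b' x by apply/im_b'; exists x.
  exact: dd.
have [H [h [surj_h ker_h]]] := cokernel_exists i'.
exists Z, H, z, c, i', h; split.
- split=> // [x|y].
    have [w dw] : exists w, d i w = b x by apply/im_b; exists x.
    exists w; apply/eqP; rewrite -subr_eq0; apply/eqP/inj_b.
    by rewrite linearB /= cE dw subrr.
  by rewrite -ker_d -cE; split=> [->|/inj_b //]; rewrite linear0.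
- by split=> // x i'x; apply: inj_b'; rewrite -i'E i'x linear0.
- move=> t; have [x <-] := surj_h t; rewrite -linear_ract; apply/ker_h.
  have /d_exact/im_b'[y yx] : d i (z x) = 0 by apply/ker_d; exists x.
  exists y; apply/eqP; rewrite -subr_eq0; apply/eqP/inj_z.
  by rewrite linearB /= i'E yx linear_ract subrr.
Qed.

Variable m : nat.
Hypothesis Ext_above : forall j, (m.+1 < j)%N -> Ext_zero j S S.

Lemma homology_Ext_above (H : rmodType R) j :
  complement_killed e H -> (m.+1 < j)%N -> Ext_zero j H S.
Proof.
move=> fH mj; apply: Ext_zero_semisimple => //; first exact: killed_top.
exact: Ext_above.
Qed.

(** Upward induction on the degree. *)
Lemma boundaries_Ext_above i (B : rmodType R) (b : {linear B -> C i}) j :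
  boundaries b -> (m < j)%N -> Ext_zero j B S.
Proof.
elim: i => [|i IH] in B b j * => Bb mj.
  have Bp : short_exact b p.
    have [inj_b im_b] := Bb; split=> // x.
    by rewrite p_exact im_b.
  case: j mj => // j mj; refine (Ext_zero_sub Bp _ _).
    by apply: Ext_zero_projective; apply: C_projective.
  exact: Ext_above.
have [B0 [b0 B0b0]] := boundaries_exist i.
have [Z [H [z [c [i' [h [exZ exH fH]]]]]]] := cycles_homology B0b0 Bb.
refine (Ext_zero_sub exH _ _); last exact: homology_Ext_above.
refine (Ext_zero_sub exZ _ _); last by apply: (IH B0 b0) => //; apply: leqW.
by case: j mj => // j _; apply: Ext_zero_projective; apply: C_projective.
Qed.

(** Downward induction on the degree, along which the homology [H] is seen to
    vanish: [Ext^(m+1)(H, S)] lies between [Ext^m(B', S)] and [Ext^(m+1)(Z, S)],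
    both zero, whereas [S] would be a retract of a nonzero [H]. *)
Lemma boundaries_Ext_zero i (B : rmodType R) (b : {linear B -> C i}) j :
  ~ Ext_zero m.+1 S S -> boundaries b -> Ext_zero j B S.
Proof.
move=> nS; have [k leN] : exists k, (N <= i + k)%N by exists N; apply: leq_addl.
elim: k => [|k IH] in i B b j leN * => Bb.
  have B0 (x : B) : x = 0.
    have [inj_b im_b] := Bb; apply: inj_b.
    have [w <-] : exists w, d i w = b x by apply/im_b; exists x.
    by rewrite (_ : w = 0) ?linear0 //; apply: C_bounded; rewrite addn0 in leN.
  case: j => [|j]; first by apply/Ext_zero0P => f x; rewrite (B0 x) linear0.
  apply: Ext_zero_projective => X Y g f _; exists \0 => x.
  by rewrite (B0 x) !linear0.
have [B' [b' B'b']] := boundaries_exist i.+1.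
have [Z [H [z [c [i' [h [exZ exH fH]]]]]]] := cycles_homology Bb B'b'.
have EB' l : Ext_zero l B' S by apply: IH B'b'; rewrite addSnnS.
have EZ : Ext_zero m.+1 Z S.
  refine (Ext_zero_sub exZ _ _).
    by apply: Ext_zero_projective; apply: C_projective.
  exact: boundaries_Ext_above Bb _.
have H0 (x : H) : x = 0.
  apply: contrapT => /eqP x0; apply: nS.
  have [s [r rs]] := top_retract eaJ fH (killed_top fH) x0.
  exact: Ext_zero_retraction rs (Ext_zero_quo exH (EB' m) EZ).
have {}EZ l : Ext_zero l Z S.
  have [inj_i' surj_h ker_h] := exH.
  have [x|r rE] := lift_inj inj_i' (g := idfun : {linear Z -> Z}).
    by apply/ker_h; apply: H0.
  exact: (Ext_zero_retraction (r := i') rE (EB' l)).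
case: j => [|j].
  apply/Ext_zero0P => g x; have [_ surj_c _] := exZ; have [y <-] := surj_c x.
  by have /Ext_zero0P/(_ (g \o c) y) := C_hom0 (i := i).
refine (Ext_zero_quo exZ (EZ j) _).
by apply: Ext_zero_projective; apply: C_projective.
Qed.

(** If [Ext^j S S] vanishes for [j > m.+1], then it vanishes for [j = m.+1]. *)
Lemma top_Ext_descend : Ext_zero m.+1 S S.
Proof.
apply: contrapT => nS.
have [B [b Bb]] := boundaries_exist 0.
have Bp : short_exact b p.
  have [inj_b im_b] := Bb; split=> // x.
  by rewrite p_exact im_b.
apply/nS; refine (Ext_zero_quo Bp (boundaries_Ext_zero nS Bb) _).
by apply: Ext_zero_projective; apply: C_projective.
Qed.

End TopExt.

(** * The complex of a resolution of [eR (1 - e)] *)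

Section CornerComplex.
Variables (R : pzRingType) (e : idem_elt R).

Local Notation J := (jacobson R).
Local Notation S := (top_eR e).
Local Notation f := (idem_compl e).

Hypothesis eafJ : forall a, (e : R) * a * (1 - (e : R)) \in J.
Hypothesis killed_top :
  forall X : rmodType R, complement_killed e X -> radical_killed X.

Variable P : proj_resolution (corner_hom f (eR e) : rmodType (corner f)).

(** The complex [... -> P_1 (x) fR -> P_0 (x) fR -> eR]. *)
Definition corner_complex i : rmodType R :=
  if i is j.+1 then induced (res P j) else eR e.

(** The differentials: their homology is killed by [f] in positive degrees, and
    is [S] in degree zero. *)
Lemma corner_complex_exists :
  exists d : forall i, {linear corner_complex i.+1 -> corner_complex i},
    [/\ forall i x, d i (d i.+1 x) = 0,
        forall i x, d i x = 0 -> exists y, d i.+1 y = x ** (1 - (e : R))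
      & forall x, top_proj e x = 0 <-> exists y, d 0 y = x].
Proof.
have [q qE] := induced_ext (res_aug P).
pose dP j := sval (cid (induced_map_exists (res_diff P j))).
have dPE j x w : dP j (tens x w) = tens (res_diff P j x) w :=
  svalP (cid (induced_map_exists (res_diff P j))) x w.
pose d i : {linear corner_complex i.+1 -> corner_complex i} :=
  if i is j.+1 then dP j else q.
exists d; split.
- case=> [|i]; apply: induced_ind => [|x y dx dy|x w].
  + by rewrite !linear0.
  + by rewrite !linearD dx dy addr0.
  + by rewrite [d 1 _]dPE [LHS]qE res_augK.
  + by rewrite !linear0.
  + by rewrite !linearD dx dy addr0.
  + by rewrite [d i.+2 _]dPE [LHS]dPE res_diffK tens0l.
- case=> [|i] z dz; have [x zx] := induced_ract_idem z; rewrite zx.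
    have [|y yx] := (res_exact0 (p := P) x).1; last first.
      by exists (tens y (eR_gen f)); rewrite [LHS]dPE yx.
    apply: corner_homP => w; rewrite /= (eR_genE w) linear_ract -qE -zx.
    by rewrite linear_ract [q z]dz !ract0r.
  have [|y yx] := (res_exactS (p := P) x).1; last first.
    by exists (tens y (eR_gen f)); rewrite [LHS]dPE yx.
  by apply: tens_gen_inj; rewrite -dPE -zx linear_ract [dP i z]dz ract0r.
move=> x; split=> [/top_proj0 xJ|[y <-]]; last first.
  apply: (@induced_hom0 _ _ _ _ (top_proj e \o q)) y.
  exact: top_complement_killed.
(* The cokernel of [q] is killed by [f] since [eRf] lies in the image of [q],
   hence it is killed by the radical. *)
have [X [p [surj_p ker_p]]] := cokernel_exists q.
apply/ker_p; rewrite (eR_genE x) linear_ract; apply: killed_top xJ => y.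
have [u <-] := surj_p y; rewrite -linear_ract; apply/ker_p.
have [g gE] := eR_hom_exists f u.
have [t tE] := res_aug_surj P (g : corner_hom f (eR e)).
by exists (tens t (eR_gen f)); rewrite qE tE /= gE eR_eltE mulr1.
Qed.

End CornerComplex.

Theorem theorem6p4 (k : closedFieldType) (A : algType k)
    (A_basic : basic_algebra A) (A_semiperfect : semiperfect_algebra A)
    (A_noetherian : noetherian_ring A)
    (A_top_fd : finite_dimensional (radquot A))
    (e : idem_elt A) (e_primitive : primitive_idem e) :
  Ext_zero 1 (top_eR e) (top_eR e) ->
  pd_finite (top_eR e) ->
  pd_finite (corner_hom (idem_compl e) (eR e)) ->
  self_orthogonal (top_eR e).
Proof.
move=> ExtS [n [Q Q_bounded]] [N [P P_bounded]].
have [_ noethA] := A_noetherian.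
have [eafJ eaJ] := primitive_basic noethA e_primitive A_semiperfect A_basic.
have killed := complement_killed_radical eaJ noethA ExtS.
have [d [dd d_exact p_exact]] := corner_complex_exists eafJ killed P.
have C_projective i : projective (corner_complex P i).
  case: i => [|i]; first exact: eR_projective.
  by apply: induced_projective; apply: res_projective.
have C_hom0 i : Ext_zero 0 (corner_complex P i.+1) (top_eR e).
  apply/Ext_zero0P => g; apply: induced_hom0.
  exact: top_complement_killed.
have C_bounded i : (N.+1 < i)%N -> forall x : corner_complex P i, x = 0.
  case: i => // i Ni; apply: induced_ind => // [x y -> ->|m u].
    by rewrite addr0.
  by rewrite (P_bounded i Ni m) tens0l.
have {Q Q_bounded} : forall j, (n < j)%N -> Ext_zero j (top_eR e) (top_eR e).
  case=> // j nj; apply: (Ext_zero_of_res (Q := Q)) => f _.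
  by exists \0 => x; rewrite (Q_bounded _ nj x) linear0.
elim: n => [|n IH] Ext_above; first exact: Ext_above.
apply: IH => j; rewrite leq_eqVlt => /orP[/eqP <-|]; last exact: Ext_above.
exact: (top_Ext_descend eaJ eafJ killed dd d_exact (@top_proj_surj _ e)
  p_exact C_projective C_hom0 C_bounded Ext_above).
Qed.
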